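(* Let $A$ be a right reversible, right partially cancellative (not necessarily commutative) pointed monoid, let $\sigma:A\to A^{\mathrm{op}}$ be an involution of pointed monoids, and let $\epsilon\in A$ be a central element with $\epsilon\sigma(\epsilon)=1$. For $M\in A\text{-}\mathsf{proj}^{\mathrm n}$ let $P^\sigma(M)$ be the set of normal homomorphisms $M\to A$ with the left $A$-action $(a\cdot f)(m)=f(m)\sigma(a)$, and let $P^\sigma$ act on morphisms by precomposition. Then the natural transformation $\Theta^{\sigma,\epsilon}:\mathrm{id}_{A\text{-}\mathsf{proj}^{\mathrm n}}\Rightarrow P^\sigma\circ(P^\sigma)^{\mathrm{op}}$ with components $$\Theta^{\sigma,\epsilon}_M(m)(f)=\epsilon\,\sigma(f(m)),\qquad f\in P^\sigma(M),\ m\in M,$$ makes $(A\text{-}\mathsf{proj}^{\mathrm n},P^\sigma,\Theta^{\sigma,\epsilon})$ into a uniquely split combinatorial proto-exact category with duality.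
   Context: A pointed monoid is a monoid $A$ (identity $1$) with an element $0$ such that $0a=a0=0$. $A$ is right partially cancellative if $xa=ya$ implies $x=y$ or $xa=ya=0$, for all $a,x,y$; right reversible if $Aa\cap Ab\neq\{0\}$ for all non-zero $a,b$. A (left) $A$-module is a pointed set with a left $A$-action fixing the basepoint and with $0\in A$ acting by zero; homomorphisms are pointed equivariant; $\oplus$ is the wedge. A homomorphism is normal if its fibres over non-basepoints are empty or singletons. $A\text{-}\mathsf{proj}^{\mathrm n}$: finitely generated projective left $A$-modules and normal homomorphisms; inflations ($\rightarrowtail$) are injective normal homomorphisms with cokernel in the category, deflations ($\twoheadrightarrow$) surjective normal homomorphisms with kernel in the category; conflations are the sequences $U\rightarrowtail X\twoheadrightarrow V$ with $U$ the kernel of $X\twoheadrightarrow V$. A proto-exact category is a category with zero object and classes of inflations and deflations such that: $0\to X$ is an inflation and $X\to0$ a deflation; both classes contain isomorphisms and are closed under composition; a commutative square with two parallel inflations and two parallel deflations is cartesian iff cocartesian; each diagram $W\rightarrowtail X\twoheadleftarrow V$, and each diagram $W\twoheadleftarrow U\rightarrowtail V$, can be completed to a bicartesian square with two parallel inflations and two parallel deflations (an admissible square). A functor is proto-exact if it preserves admissible squares. An exact direct sum is a symmetric monoidal structure $\oplus$ with unit $0$ that is proto-exact and such that (i) $\mathrm{Hom}(U\oplus V,W)\to\mathrm{Hom}(U,W)\times\mathrm{Hom}(V,W)$ is injective; (ii) for a conflation $U\overset{i}{\rightarrowtail}X\overset{\pi}{\twoheadrightarrow}V$ and a section $s$ of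 $\pi$ there is a unique isomorphism $\phi:U\oplus V\to X$ with $\phi i_U=i$, $\phi i_V=s$; and the duals of (i), (ii) hold. Uniquely split: every conflation $U\overset{i}{\rightarrowtail}X\overset{\pi}{\twoheadrightarrow}V$ admits a unique isomorphism $\phi:U\oplus V\to X$ with $\phi i_U=i$, $\pi\phi=\pi_V$. Combinatorial: every inflation $U\rightarrowtail X_1\oplus X_2$ is, up to an isomorphism $U\simeq U_1\oplus U_2$, of the form $i_1\oplus i_2$ with inflations $i_k:U_k\rightarrowtail X_k$, and dually for deflations out of $X_1\oplus X_2$. A proto-exact category with duality (and exact direct sum) is a triple $(\mathcal A,P,\Theta)$ with $P:\mathcal A^{\mathrm{op}}\to\mathcal A$ proto-exact and $\oplus$-monoidal and $\Theta:\mathrm{id}\Rightarrow P\circ P^{\mathrm{op}}$ a $\oplus$-monoidal natural isomorphism satisfying $P(\Theta_U)\circ\Theta_{P(U)}=\mathrm{id}_{P(U)}$ for all $U$. *)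

(* Defs.v *)
From HB Require Import structures.
From mathcomp Require Import ssreflect ssrfun ssrbool eqtype choice ssrnat seq.
From mathcomp Require Import fintype monoid.
From mathcomp Require Import boolp.

Set Implicit Arguments.
Unset Strict Implicit.
Unset Printing Implicit Defensive.

Declare Scope cat_scope.
Delimit Scope cat_scope with cat.
Local Open Scope cat_scope.

Record category := Category {
  obj :> Type;
  hom : obj -> obj -> Type;
  idm : forall X, hom X X;
  comp : forall X Y Z, hom Y Z -> hom X Y -> hom X Z;
  comp1m : forall X Y (f : hom X Y), comp (idm Y) f = f;
  compm1 : forall X Y (f : hom X Y), comp f (idm X) = f;
  compmA : forall X Y Z W (h : hom Z W) (g : hom Y Z) (f : hom X Y),
    comp h (comp g f) = comp (comp h g) f
}.
Arguments hom {_} _ _.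
Arguments idm {_} _.
Arguments comp {_ _ _ _} _ _.
Notation "g \oc f" := (comp g f) (at level 40, left associativity) : cat_scope.

Definition op (C : category) : category :=
  @Category C (fun X Y => @hom C Y X) (fun X => idm X)
    (fun X Y Z g f => f \oc g)
    (fun X Y f => compm1 f) (fun X Y f => comp1m f)
    (fun X Y Z W h g f => esym (compmA f g h)).

Lemma prodc_comp1m (C D : category) (X Y : C * D)
    (f : hom X.1 Y.1 * hom X.2 Y.2) :
  (idm Y.1 \oc f.1, idm Y.2 \oc f.2) = f.
Proof. by case: f => f g; rewrite !comp1m. Qed.

Lemma prodc_compm1 (C D : category) (X Y : C * D)
    (f : hom X.1 Y.1 * hom X.2 Y.2) :
  (f.1 \oc idm X.1, f.2 \oc idm X.2) = f.
Proof. by case: f => f g; rewrite !compm1. Qed.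

Definition prodc (C D : category) : category :=
  @Category (C * D)%type
    (fun X Y => (hom X.1 Y.1 * hom X.2 Y.2)%type)
    (fun X => (idm X.1, idm X.2))
    (fun X Y Z g f => (g.1 \oc f.1, g.2 \oc f.2))
    (@prodc_comp1m C D) (@prodc_compm1 C D)
    (fun X Y Z W h g f =>
       f_equal2 pair (compmA h.1 g.1 f.1) (compmA h.2 g.2 f.2)).

Record functor (C D : category) := Functor {
  fobj :> C -> D;
  fmap : forall X Y, hom X Y -> hom (fobj X) (fobj Y);
  fmap1 : forall X, fmap (idm X) = idm (fobj X);
  fmapM : forall X Y Z (g : hom Y Z) (f : hom X Y),
    fmap (g \oc f) = fmap g \oc fmap f
}.
Arguments fmap {_ _} _ {_ _} _.

Definition is_iso (C : category) (X Y : C) (f : hom X Y) : Prop :=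
  exists g : hom Y X, g \oc f = idm X /\ f \oc g = idm Y.

Record iso (C : category) (X Y : C) := Iso {
  ito :> hom X Y;
  ifrom : hom Y X;
  itoK : ifrom \oc ito = idm X;
  ifromK : ito \oc ifrom = idm Y
}.

Definition op_iso (C : category) (X Y : C) (f : iso X Y) :
    @iso (op C) X Y :=
  @Iso (op C) X Y (ifrom f) (ito f) (itoK f) (ifromK f).

Record zero_object (C : category) := ZeroObject {
  zob :> C;
  from0 : forall X : C, hom zob X;
  to0 : forall X : C, hom X zob;
  from0_uniq : forall (X : C) (f : hom zob X), f = from0 X;
  to0_uniq : forall (X : C) (f : hom X zob), f = to0 X
}.

Definition op_zero (C : category) (Z : zero_object C) : zero_object (op C) :=
  @ZeroObject (op C) Z (to0 Z) (from0 Z)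
    (@to0_uniq C Z) (@from0_uniq C Z).

Definition zero_hom (C : category) (Z : zero_object C) (X Y : C) : hom X Y :=
  from0 Z Y \oc to0 Z X.

Definition is_kernel (C : category) (Z : zero_object C) (K X Y : C)
    (k : hom K X) (f : hom X Y) : Prop :=
  f \oc k = zero_hom Z K Y /\
  forall (T : C) (t : hom T X), f \oc t = zero_hom Z T Y ->
    exists! u : hom T K, k \oc u = t.

Definition is_cokernel (C : category) (Z : zero_object C) (X Y Q : C)
    (c : hom Y Q) (f : hom X Y) : Prop :=
  @is_kernel (op C) (op_zero Z) Q Y X c f.

(* Squares are given as [i : U -> X], [p : U -> W], [q : X -> V],
   [j : W -> V], with [i] parallel to [j] and [p] parallel to [q]. *)
Definition cartesian (C : category) (U X W V : C)
    (i : hom U X) (p : hom U W) (q : hom X V) (j : hom W V) : Prop :=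
  forall (T : C) (x : hom T X) (w : hom T W), q \oc x = j \oc w ->
    exists! u : hom T U, i \oc u = x /\ p \oc u = w.

Definition cocartesian (C : category) (U X W V : C)
    (i : hom U X) (p : hom U W) (q : hom X V) (j : hom W V) : Prop :=
  forall (T : C) (x : hom X T) (w : hom W T), x \oc i = w \oc p ->
    exists! v : hom V T, v \oc q = x /\ v \oc j = w.

Record exact_classes (C : category) := ExactClasses {
  inflation : forall X Y : C, hom X Y -> Prop;
  deflation : forall X Y : C, hom X Y -> Prop
}.
Arguments inflation {_} _ {_ _} _.
Arguments deflation {_} _ {_ _} _.

Definition op_classes (C : category) (E : exact_classes C) :
    exact_classes (op C) :=
  @ExactClasses (op C) (fun X Y f => @deflation C E Y X f)
    (fun X Y f => @inflation C E Y X f).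

Definition prod_classes (C D : category) (E : exact_classes C)
    (F : exact_classes D) : exact_classes (prodc C D) :=
  @ExactClasses (prodc C D)
    (fun X Y f => inflation E f.1 /\ inflation F f.2)
    (fun X Y f => deflation E f.1 /\ deflation F f.2).

Definition exact_square (C : category) (E : exact_classes C) (U X W V : C)
    (i : hom U X) (p : hom U W) (q : hom X V) (j : hom W V) : Prop :=
  [/\ inflation E i, inflation E j, deflation E p, deflation E q &
      q \oc i = j \oc p].

Definition admissible_square (C : category) (E : exact_classes C)
    (U X W V : C)
    (i : hom U X) (p : hom U W) (q : hom X V) (j : hom W V) : Prop :=
  [/\ exact_square E i p q j, cartesian i p q j & cocartesian i p q j].

Record proto_exact (C : category) (Z : zero_object C)
    (E : exact_classes C) : Prop := {
  inflation_from0 : forall X : C, inflation E (from0 Z X);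
  deflation_to0 : forall X : C, deflation E (to0 Z X);
  inflation_iso : forall (X Y : C) (f : hom X Y), is_iso f -> inflation E f;
  deflation_iso : forall (X Y : C) (f : hom X Y), is_iso f -> deflation E f;
  inflation_comp : forall (X Y T : C) (g : hom Y T) (f : hom X Y),
    inflation E g -> inflation E f -> inflation E (g \oc f);
  deflation_comp : forall (X Y T : C) (g : hom Y T) (f : hom X Y),
    deflation E g -> deflation E f -> deflation E (g \oc f);
  exact_square_bicartesian : forall (U X W V : C)
    (i : hom U X) (p : hom U W) (q : hom X V) (j : hom W V),
    exact_square E i p q j -> (cartesian i p q j <-> cocartesian i p q j);
  admissible_pullback : forall (X W V : C) (q : hom X V) (j : hom W V),
    deflation E q -> inflation E j ->
    exists (U : C) (i : hom U X) (p : hom U W), admissible_square E i p q j;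
  admissible_pushout : forall (U X W : C) (i : hom U X) (p : hom U W),
    inflation E i -> deflation E p ->
    exists (V : C) (q : hom X V) (j : hom W V), admissible_square E i p q j
}.

Definition proto_exact_functor (C D : category) (EC : exact_classes C)
    (ED : exact_classes D) (F : functor C D) : Prop :=
  forall (U X W V : C)
    (i : hom U X) (p : hom U W) (q : hom X V) (j : hom W V),
    admissible_square EC i p q j ->
    admissible_square ED (fmap F i) (fmap F p) (fmap F q) (fmap F j).

Definition conflation (C : category) (Z : zero_object C)
    (E : exact_classes C) (U X V : C) (i : hom U X) (p : hom X V) : Prop :=
  [/\ inflation E i, deflation E p & is_kernel Z i p].

Lemma tensor_op_fmap1 (C : category) (T : functor (prodc C C) C)
    (X : C * C) :
  @fmap (prodc C C) C T X X (idm X.1, idm X.2) = idm (T X).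
Proof. exact: (fmap1 T X). Qed.

Definition op_bifunctor (C : category) (T : functor (prodc C C) C) :
    functor (prodc (op C) (op C)) (op C) :=
  @Functor (prodc (op C) (op C)) (op C) T
    (fun X Y f => @fmap (prodc C C) C T Y X f)
    (tensor_op_fmap1 T)
    (fun X Y Z g f => @fmapM (prodc C C) C T Z Y X f g).

Definition tobj (C : category) (T : functor (prodc C C) C) (X Y : C) : C :=
  T (X, Y).

Definition tmap (C : category) (T : functor (prodc C C) C) (X X' Y Y' : C)
    (f : hom X X') (g : hom Y Y') : hom (tobj T X Y) (tobj T X' Y') :=
  @fmap (prodc C C) C T (X, Y) (X', Y') (f, g).

Record tensor_data (C : category) (I : C) := TensorData {
  tens : functor (prodc C C) C;
  assoc : forall X Y W : C,
    iso (tobj tens (tobj tens X Y) W) (tobj tens X (tobj tens Y W));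
  lunit : forall X : C, iso (tobj tens I X) X;
  runit : forall X : C, iso (tobj tens X I) X;
  braid : forall X Y : C, iso (tobj tens X Y) (tobj tens Y X)
}.

Notation "f \ot[ S ] g" := (tmap (tens S) f g)
  (at level 35, S at level 0, format "f  \ot[ S ]  g") : cat_scope.
Notation "X \oplus[ S ] Y" := (tobj (tens S) X Y)
  (at level 35, S at level 0, format "X  \oplus[ S ]  Y") : cat_scope.

Definition op_tensor (C : category) (I : C) (S : tensor_data I) :
    @tensor_data (op C) I :=
  @TensorData (op C) I (op_bifunctor (tens S))
    (fun X Y W => op_iso (assoc S X Y W))
    (fun X => op_iso (lunit S X)) (fun X => op_iso (runit S X))
    (fun X Y => op_iso (braid S X Y)).

Record symmetric_monoidal (C : category) (I : C) (S : tensor_data I) : Prop := {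
  assoc_natural : forall (X X' Y Y' W W' : C)
    (f : hom X X') (g : hom Y Y') (h : hom W W'),
    assoc S X' Y' W' \oc ((f \ot[S] g) \ot[S] h) =
    (f \ot[S] (g \ot[S] h)) \oc assoc S X Y W;
  lunit_natural : forall (X X' : C) (f : hom X X'),
    lunit S X' \oc (idm I \ot[S] f) = f \oc lunit S X;
  runit_natural : forall (X X' : C) (f : hom X X'),
    runit S X' \oc (f \ot[S] idm I) = f \oc runit S X;
  braid_natural : forall (X X' Y Y' : C) (f : hom X X') (g : hom Y Y'),
    braid S X' Y' \oc (f \ot[S] g) = (g \ot[S] f) \oc braid S X Y;
  pentagon : forall X Y W V : C,
    (idm X \ot[S] assoc S Y W V) \oc assoc S X (Y \oplus[S] W) V
      \oc (assoc S X Y W \ot[S] idm V) =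
    assoc S X Y (W \oplus[S] V) \oc assoc S (X \oplus[S] Y) W V;
  triangle : forall X Y : C,
    (idm X \ot[S] lunit S Y) \oc assoc S X I Y = runit S X \ot[S] idm Y;
  hexagon : forall X Y W : C,
    assoc S Y W X \oc braid S X (Y \oplus[S] W) \oc assoc S X Y W =
    (idm Y \ot[S] braid S X W) \oc assoc S Y X W
      \oc (braid S X Y \ot[S] idm W);
  braid_symmetric : forall X Y : C,
    braid S Y X \oc braid S X Y = idm (X \oplus[S] Y)
}.

Record monoidal_data (C D : category) (I : C) (J : D)
    (S : tensor_data I) (T : tensor_data J) (F : functor C D) :=
  MonoidalData {
    mu : forall X Y : C, iso (F X \oplus[T] F Y) (F (X \oplus[S] Y));
    eta : iso J (F I)
  }.

Record monoidal_functor (C D : category) (I : C) (J : D)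
    (S : tensor_data I) (T : tensor_data J) (F : functor C D)
    (m : monoidal_data S T F) : Prop := {
  mu_natural : forall (X X' Y Y' : C) (f : hom X X') (g : hom Y Y'),
    mu m X' Y' \oc (fmap F f \ot[T] fmap F g) =
    fmap F (f \ot[S] g) \oc mu m X Y;
  mu_assoc : forall X Y W : C,
    fmap F (assoc S X Y W) \oc mu m (X \oplus[S] Y) W
      \oc (mu m X Y \ot[T] idm (F W)) =
    mu m X (Y \oplus[S] W) \oc (idm (F X) \ot[T] mu m Y W)
      \oc assoc T (F X) (F Y) (F W);
  mu_lunit : forall X : C,
    fmap F (lunit S X) \oc mu m I X \oc (eta m \ot[T] idm (F X)) =
    lunit T (F X);
  mu_runit : forall X : C,
    fmap F (runit S X) \oc mu m X I \oc (idm (F X) \ot[T] eta m) =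
    runit T (F X);
  mu_braid : forall X Y : C,
    fmap F (braid S X Y) \oc mu m X Y = mu m Y X \oc braid T (F X) (F Y)
}.

Section DirectSum.
Variables (C : category) (Z : zero_object C) (S : tensor_data (zob Z)).
Variable E : exact_classes C.

Definition inl_sum (U V : C) : hom U (U \oplus[S] V) :=
  (idm U \ot[S] from0 Z V) \oc ifrom (runit S U).
Definition inr_sum (U V : C) : hom V (U \oplus[S] V) :=
  (from0 Z U \ot[S] idm V) \oc ifrom (lunit S V).
Definition prl_sum (U V : C) : hom (U \oplus[S] V) U :=
  runit S U \oc (idm U \ot[S] to0 Z V).
Definition prr_sum (U V : C) : hom (U \oplus[S] V) V :=
  lunit S V \oc (to0 Z U \ot[S] idm V).

(* [sum_mono] and [sum_retraction] are the duals of [sum_epi] and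
   [sum_section]. *)
Record exact_direct_sum : Prop := {
  sum_symmetric_monoidal : symmetric_monoidal S;
  sum_proto_exact : proto_exact_functor (prod_classes E E) E (tens S);
  sum_epi : forall (U V W : C) (f g : hom (U \oplus[S] V) W),
    f \oc inl_sum U V = g \oc inl_sum U V ->
    f \oc inr_sum U V = g \oc inr_sum U V -> f = g;
  sum_mono : forall (U V W : C) (f g : hom W (U \oplus[S] V)),
    prl_sum U V \oc f = prl_sum U V \oc g ->
    prr_sum U V \oc f = prr_sum U V \oc g -> f = g;
  sum_section : forall (U X V : C) (i : hom U X) (p : hom X V) (s : hom V X),
    conflation Z E i p -> p \oc s = idm V ->
    exists! phi : hom (U \oplus[S] V) X,
      [/\ is_iso phi, phi \oc inl_sum U V = i & phi \oc inr_sum U V = s];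
  sum_retraction : forall (U X V : C) (i : hom U X) (p : hom X V)
      (r : hom X U),
    conflation Z E i p -> r \oc i = idm U ->
    exists! phi : hom X (U \oplus[S] V),
      [/\ is_iso phi, prl_sum U V \oc phi = r & prr_sum U V \oc phi = p]
}.

Definition uniquely_split : Prop :=
  forall (U X V : C) (i : hom U X) (p : hom X V), conflation Z E i p ->
    exists! phi : hom (U \oplus[S] V) X,
      [/\ is_iso phi, phi \oc inl_sum U V = i & p \oc phi = prr_sum U V].

Definition combinatorial : Prop :=
  (forall (U X1 X2 : C) (i : hom U (X1 \oplus[S] X2)), inflation E i ->
    exists (U1 U2 : C) (phi : iso U (U1 \oplus[S] U2))
        (i1 : hom U1 X1) (i2 : hom U2 X2),
      [/\ inflation E i1, inflation E i2 & i = (i1 \ot[S] i2) \oc phi]) /\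
  (forall (X1 X2 V : C) (p : hom (X1 \oplus[S] X2) V), deflation E p ->
    exists (V1 V2 : C) (phi : iso (V1 \oplus[S] V2) V)
        (p1 : hom X1 V1) (p2 : hom X2 V2),
      [/\ deflation E p1, deflation E p2 & p = phi \oc (p1 \ot[S] p2)]).

Section Duality.
Variable P : functor (op C) C.

Definition dmap (X Y : C) (f : hom X Y) : hom (P Y) (P X) :=
  @fmap (op C) C P Y X f.

(* Monoidality of [Theta] refers to the structure morphisms
   [P mu^-1 \oc mu] and [P eta^-1 \oc eta] induced on [P \o P^op]. *)
Record is_duality (Theta : forall X : C, hom X (P (P X))) : Prop := {
  duality_proto_exact : proto_exact_functor (op_classes E) E P;
  duality_monoidal : exists m : monoidal_data (op_tensor S) S P,
    [/\ monoidal_functor m,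
        forall U V : C,
          Theta (U \oplus[S] V) =
          dmap (ifrom (mu m U V)) \oc mu m (P U) (P V)
            \oc (Theta U \ot[S] Theta V) &
        Theta (zob Z) = dmap (ifrom (eta m)) \oc eta m];
  duality_natural : forall (X Y : C) (f : hom X Y),
    Theta Y \oc f = dmap (dmap f) \oc Theta X;
  duality_iso : forall X : C, is_iso (Theta X);
  duality_coherence : forall U : C,
    dmap (Theta U) \oc Theta (P U) = idm (P U)
}.

Record proto_exact_with_duality (Theta : forall X : C, hom X (P (P X))) :
    Prop := {
  with_duality_proto_exact : proto_exact Z E;
  with_duality_direct_sum : exact_direct_sum;
  with_duality_is_duality : is_duality Theta
}.

End Duality.
End DirectSum.

HB.mixin Record Monoid_hasZero A of monoid.Monoid A := {
  pzero : A;
  pzero_mul : left_zero pzero (@mul A);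
  mul_pzero : right_zero pzero (@mul A)
}.

#[short(type="pointedMonoidType")]
HB.structure Definition PointedMonoid :=
  {A of monoid.Monoid A & Monoid_hasZero A}.

Bind Scope group_scope with PointedMonoid.sort.
Notation "1" := (@one _) : group_scope.
Notation "0" := (@pzero _) : group_scope.
Local Open Scope group_scope.

Definition right_partially_cancellative (A : pointedMonoidType) : Prop :=
  forall a x y : A, x * a = y * a -> x = y \/ (x * a = 0 /\ y * a = 0).

Definition right_reversible (A : pointedMonoidType) : Prop :=
  forall a b : A, a <> 0 -> b <> 0 ->
    exists x y : A, x * a = y * b /\ x * a <> 0.

Record pm_involution (A : pointedMonoidType) (sigma : A -> A) : Prop := {
  invol1 : sigma 1 = 1;
  invol0 : sigma 0 = 0;
  involM : forall a b : A, sigma (a * b) = sigma b * sigma a;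
  involK : involutive sigma
}.

Record module (A : pointedMonoidType) := Module {
  mcar :> Type;
  base : mcar;
  act : A -> mcar -> mcar;
  act_base : forall a, act a base = base;
  act0 : forall m, act 0 m = base;
  act1 : forall m, act 1 m = m;
  actM : forall a b m, act (a * b) m = act a (act b m)
}.
Arguments base {A} _.
Arguments act {A m} _ _ : rename.

Definition regular (A : pointedMonoidType) : module A :=
  @Module A A 0 *%g mul_pzero pzero_mul mul1g (fun a b m => esym (mulgA a b m)).

Section Modules.
Variable A : pointedMonoidType.
Implicit Types M N : module A.

Record mhom M N := MHom {
  mfun :> M -> N;
  mfun_base : mfun (base M) = base N;
  mfun_act : forall a m, mfun (act a m) = act a (mfun m)
}.

Lemma mhom_eq M N (f g : mhom M N) : (forall m, f m = g m) -> f = g.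
Proof.
case: f g => [f f0 fa] [g g0 ga] /= /funext fg; rewrite -{}fg in g0 ga *.
by congr MHom; exact: Prop_irrelevance.
Qed.

Definition mid M : mhom M M := @MHom M M id erefl (fun _ _ => erefl).

Lemma mcomp_base M N L (g : mhom N L) (f : mhom M N) :
  g (f (base M)) = base L.
Proof. by rewrite !mfun_base. Qed.

Lemma mcomp_act M N L (g : mhom N L) (f : mhom M N) a m :
  g (f (act a m)) = act a (g (f m)).
Proof. by rewrite !mfun_act. Qed.

Definition mcomp M N L (g : mhom N L) (f : mhom M N) : mhom M L :=
  MHom (mcomp_base g f) (mcomp_act g f).

Lemma mcomp1m M N (f : mhom M N) : mcomp (mid N) f = f.
Proof. exact: mhom_eq. Qed.

Lemma mcompm1 M N (f : mhom M N) : mcomp f (mid M) = f.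
Proof. exact: mhom_eq. Qed.

Lemma mcompA M N L K (h : mhom L K) (g : mhom N L) (f : mhom M N) :
  mcomp h (mcomp g f) = mcomp (mcomp h g) f.
Proof. exact: mhom_eq. Qed.

Definition modcat : category :=
  @Category (module A) mhom mid mcomp mcomp1m mcompm1 mcompA.

Lemma unit_all (x : unit) : tt = x. Proof. by case: x. Qed.

Definition zero_module : module A :=
  @Module A unit tt (fun _ _ => tt) (fun=> erefl) (fun=> erefl)
    unit_all (fun _ _ _ => erefl).

Definition mfrom0 M : mhom zero_module M :=
  @MHom zero_module M (fun=> base M) erefl (fun a _ => esym (act_base M a)).

Definition mto0 M : mhom M zero_module :=
  @MHom M zero_module (fun=> tt) erefl (fun _ _ => erefl).

Lemma mfrom0_uniq M (f : mhom zero_module M) : f = mfrom0 M.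
Proof. by apply: mhom_eq => -[]; rewrite (mfun_base f). Qed.

Lemma mto0_uniq M (f : mhom M zero_module) : f = mto0 M.
Proof. by apply: mhom_eq => m; case: (f m). Qed.

Definition modcat_zero : zero_object modcat :=
  @ZeroObject modcat zero_module mfrom0 mto0 mfrom0_uniq mto0_uniq.

Definition surjective M N (f : mhom M N) : Prop :=
  forall n, exists m, f m = n.

Definition normal M N (f : mhom M N) : Prop :=
  forall n, n <> base N -> forall x y, f x = n -> f y = n -> x = y.

Definition fin_generated M : Prop :=
  exists (n : nat) (g : 'I_n -> M),
    forall m, m = base M \/ exists i a, m = act a (g i).

Definition projective M : Prop :=
  forall N L (q : mhom N L) (f : mhom M L), surjective q ->
    exists h : mhom M N, mcomp q h = f.

Definition fg_projective M : Prop := fin_generated M /\ projective M.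

(* The wedge of pointed sets, realised inside their product. *)
Definition wedge_car M N : Type :=
  {p : M * N | p.1 = base M \/ p.2 = base N}.

Lemma wedge_eq M N (p q : wedge_car M N) : sval p = sval q -> p = q.
Proof.
case: p q => [p hp] [q hq] /= pq; rewrite -{}pq in hq *.
by congr exist; exact: Prop_irrelevance.
Qed.

Lemma wedge_act_subproof M N (a : A) (p : wedge_car M N) :
  act a (sval p).1 = base M \/ act a (sval p).2 = base N.
Proof. by case: (svalP p) => /= ->; [left|right]; exact: act_base. Qed.

Definition wedge_base M N : wedge_car M N :=
  exist _ (base M, base N) (or_introl erefl).

Definition wedge_act M N (a : A) (p : wedge_car M N) : wedge_car M N :=
  exist _ (act a (sval p).1, act a (sval p).2) (wedge_act_subproof a p).

Lemma wedge_act_base M N a : wedge_act a (wedge_base M N) = wedge_base M N.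
Proof. by apply: wedge_eq; rewrite /= !act_base. Qed.

Lemma wedge_act0 M N (p : wedge_car M N) : wedge_act 0 p = wedge_base M N.
Proof. by apply: wedge_eq; rewrite /= !act0. Qed.

Lemma wedge_act1 M N (p : wedge_car M N) : wedge_act 1 p = p.
Proof. by apply: wedge_eq; rewrite /= !act1; case: (sval p). Qed.

Lemma wedge_actM M N a b (p : wedge_car M N) :
  wedge_act (a * b) p = wedge_act a (wedge_act b p).
Proof. by apply: wedge_eq; rewrite /= !actM. Qed.

Definition wedge M N : module A :=
  @Module A (wedge_car M N) (wedge_base M N) (@wedge_act M N)
    (@wedge_act_base M N) (@wedge_act0 M N) (@wedge_act1 M N)
    (@wedge_actM M N).

Record nhom M N := NHom {
  nfun :> mhom M N;
  nhom_normal : normal nfun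
}.
Arguments nhom_normal {M N} _.

Lemma nhom_eq M N (f g : nhom M N) : (forall m, f m = g m) -> f = g.
Proof.
case: f g => [f nf] [g ng] /= /mhom_eq fg; rewrite -{}fg in ng *.
by congr NHom; exact: Prop_irrelevance.
Qed.

Lemma normalE M N (f : nhom M N) x y :
  f x = f y -> f x <> base N -> x = y.
Proof. by move=> xy x0; apply: (nhom_normal f (f x)). Qed.

Lemma normal_id M : normal (mid M).
Proof. by move=> n _ x y /= -> ->. Qed.

Lemma normal_comp M N L (g : mhom N L) (f : mhom M N) :
  normal g -> normal f -> normal (mcomp g f).
Proof.
move=> ng nf l l0 x y /= gx gy.
have fxy : f x = f y by apply: (ng l).
apply: (nf (f y)) => // fy0; apply: l0.
by rewrite -gy fy0 mfun_base.
Qed.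

Definition nid M : nhom M M := NHom (@normal_id M).

Definition ncomp M N L (g : nhom N L) (f : nhom M N) : nhom M L :=
  NHom (normal_comp (nhom_normal g) (nhom_normal f)).

Record projmod := ProjMod {
  pmod :> module A;
  projmodP : fg_projective pmod
}.

Lemma ncomp1m M N (f : nhom M N) : ncomp (nid N) f = f.
Proof. exact: nhom_eq. Qed.

Lemma ncompm1 M N (f : nhom M N) : ncomp f (nid M) = f.
Proof. exact: nhom_eq. Qed.

Lemma ncompA M N L K (h : nhom L K) (g : nhom N L) (f : nhom M N) :
  ncomp h (ncomp g f) = ncomp (ncomp h g) f.
Proof. exact: nhom_eq. Qed.

Definition projn : category :=
  @Category projmod (fun X Y => nhom X Y) (fun X => nid X)
    (fun X Y W g f => ncomp g f) (fun X Y => @ncomp1m X Y)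
    (fun X Y => @ncompm1 X Y) (fun X Y W V => @ncompA X Y W V).

Lemma zero_module_fg_projective : fg_projective zero_module.
Proof.
split; first by exists 0%N, (fun=> tt) => -[]; left.
by move=> N L q f _; exists (mfrom0 N); rewrite [RHS]mfrom0_uniq [LHS]mfrom0_uniq.
Qed.

Definition projn_zero_module : projn := ProjMod zero_module_fg_projective.

Lemma normal_from0 M : normal (mfrom0 M).
Proof. by move=> n n0 x y /= xn; case: n0. Qed.

Lemma normal_to0 M : normal (mto0 M).
Proof. by move=> [] /=. Qed.

Lemma nfrom0_uniq M (f : nhom zero_module M) : f = NHom (@normal_from0 M).
Proof. by apply: nhom_eq => m; rewrite (mfrom0_uniq f). Qed.

Lemma nto0_uniq M (f : nhom M zero_module) : f = NHom (@normal_to0 M).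
Proof. by apply: nhom_eq => m; rewrite (mto0_uniq f). Qed.

Definition projn_zero : zero_object projn :=
  @ZeroObject projn projn_zero_module
    (fun M : projmod => NHom (@normal_from0 M))
    (fun M : projmod => NHom (@normal_to0 M))
    (fun M : projmod => @nfrom0_uniq M) (fun M : projmod => @nto0_uniq M).

(* Injective, respectively surjective, normal homomorphisms whose cokernel,
   respectively kernel, formed in the category of all modules is finitely
   generated and projective. *)
Definition projn_classes : exact_classes projn :=
  @ExactClasses projn
    (fun (M N : projmod) (f : nhom M N) => injective f /\
       exists (Q : module A) (c : mhom N Q),
         fg_projective Q /\
         @is_cokernel modcat modcat_zero M N Q c f)
    (fun (M N : projmod) (f : nhom M N) => surjective f /\
       exists (K : module A) (k : mhom K M),
         fg_projective K /\
         @is_kernel modcat modcat_zero K M N k f).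

Lemma wedge_fg_projective M N :
  fg_projective M -> fg_projective N -> fg_projective (wedge M N).
Proof.
pose jl (m : M) : wedge M N := exist _ (m, base N) (or_intror erefl).
pose jr (n : N) : wedge M N := exist _ (base M, n) (or_introl erefl).
move=> [[nM [gM gMP]] pM] [[nN [gN gNP]] pN]; split.
  exists (nM + nN), (fun i => match split i with
    | inl j => jl (gM j) | inr j => jr (gN j) end).
  move=> -[[m n] /= [m0|n0]].
  - case: (gNP n) => [n0|[i [a na]]].
      by left; apply: wedge_eq; rewrite /= m0 n0.
    right; exists (rshift nM i), a; rewrite (unsplitK (inr i)).
    by apply: wedge_eq; rewrite /= m0 act_base -na.
  - case: (gMP m) => [m0|[i [a ma]]].
      by left; apply: wedge_eq; rewrite /= m0 n0.
    right; exists (lshift nN i), a; rewrite (unsplitK (inl i)).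
    by apply: wedge_eq; rewrite /= n0 act_base -ma.
move=> K L q f qs.
have jl_base : f (jl (base M)) = base L.
  by rewrite -(mfun_base f); congr (f _); apply: wedge_eq.
have jr_base : f (jr (base N)) = base L.
  by rewrite -(mfun_base f); congr (f _); apply: wedge_eq.
have jl_act a m : f (jl (act a m)) = act a (f (jl m)).
  by rewrite -mfun_act; congr (f _); apply: wedge_eq; rewrite /= act_base.
have jr_act a n : f (jr (act a n)) = act a (f (jr n)).
  by rewrite -mfun_act; congr (f _); apply: wedge_eq; rewrite /= act_base.
have [hM hMP] := pM K L q (MHom jl_base jl_act) qs.
have [hN hNP] := pN K L q (MHom jr_base jr_act) qs.
pose h (p : wedge M N) : K :=
  if pselect ((sval p).1 = base M) then hN (sval p).2 else hM (sval p).1.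
have hl (p : wedge M N) : (sval p).2 = base N -> h p = hM (sval p).1.
  by rewrite /h => p2; case: pselect => [p1|//] /=; rewrite p1 p2 !mfun_base.
have hr (p : wedge M N) : (sval p).1 = base M -> h p = hN (sval p).2.
  by rewrite /h => p1; case: pselect.
have h_base : h (base (wedge M N)) = base K by rewrite hr //= mfun_base.
have h_act a p : h (act a p) = act a (h p).
  case: (svalP p) => p0.
    by rewrite !hr //= ?mfun_act // p0 act_base.
  by rewrite !hl //= ?mfun_act // p0 act_base.
exists (MHom h_base h_act); apply: mhom_eq => p /=.
case: (svalP p) => p0.
  rewrite hr // -[q _]/(mcomp q hN (sval p).2) hNP /=.
  by congr (f _); apply: wedge_eq => /=; case: p p0 => -[m n] /= _ ->.
rewrite hl // -[q _]/(mcomp q hM (sval p).1) hMP /=.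
by congr (f _); apply: wedge_eq => /=; case: p p0 => -[m n] /= _ ->.
Qed.

End Modules.

Section Wedge.
Variable A : pointedMonoidType.
Implicit Types M N L : projn A.

Definition pwedge M N : projn A :=
  ProjMod (wedge_fg_projective (projmodP M) (projmodP N)).

Lemma inj_normal (X Y : module A) (f : mhom X Y) : injective f -> normal f.
Proof. by move=> fI n _ x y <- yx; apply: fI. Qed.

Lemma wedge_map_subproof M M' N N' (f : nhom M M') (g : nhom N N')
    (p : wedge M N) :
  f (sval p).1 = base M' \/ g (sval p).2 = base N'.
Proof. by case: (svalP p) => /= ->; [left|right]; exact: mfun_base. Qed.

Definition wedge_fun M M' N N' (f : nhom M M') (g : nhom N N')
    (p : wedge M N) : wedge M' N' :=
  exist _ (f (sval p).1, g (sval p).2) (wedge_map_subproof f g p).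

Lemma wedge_fun_base M M' N N' (f : nhom M M') (g : nhom N N') :
  wedge_fun f g (base _) = base _.
Proof. by apply: wedge_eq; rewrite /= !mfun_base. Qed.

Lemma wedge_fun_act M M' N N' (f : nhom M M') (g : nhom N N') a p :
  wedge_fun f g (act a p) = act a (wedge_fun f g p).
Proof. by apply: wedge_eq; rewrite /= !mfun_act. Qed.

Lemma wedge_fun_normal M M' N N' (f : nhom M M') (g : nhom N N') :
  normal (MHom (wedge_fun_base f g) (wedge_fun_act f g)).
Proof.
move=> n n0 p r pn rn; rewrite -{}rn in n0 pn.
have [f_pr g_pr] : f (sval p).1 = f (sval r).1 /\ g (sval p).2 = g (sval r).2.
  by move/(congr1 sval): pn => /= -[-> ->].
apply: wedge_eq; rewrite [sval p]surjective_pairing [sval r]surjective_pairing.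
have [fr0|fr0] := pselect (f (sval r).1 = base M').
  have gr0 : g (sval r).2 <> base N'.
    by move=> gr0; apply: n0; apply: wedge_eq; rewrite /= fr0 gr0.
  have pr2 : (sval p).2 = (sval r).2 by apply: (normalE g_pr); rewrite g_pr.
  have r20 : (sval r).2 <> base N by move=> e; rewrite e mfun_base in gr0.
  rewrite pr2; congr pair; case: (svalP r) => // ->.
  by case: (svalP p) => // p20; case: r20; rewrite -pr2.
have pr1 : (sval p).1 = (sval r).1 by apply: (normalE f_pr); rewrite f_pr.
have r10 : (sval r).1 <> base M by move=> e; rewrite e mfun_base in fr0.
rewrite pr1; congr pair; case: (svalP r) => // ->.
by case: (svalP p) => // p10; case: r10; rewrite -pr1.
Qed.

Definition wedge_map M M' N N' (f : nhom M M') (g : nhom N N') :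
    nhom (wedge M N) (wedge M' N') :=
  NHom (@wedge_fun_normal M M' N N' f g).

Lemma wedge_map1 (X : prodc (projn A) (projn A)) :
  wedge_map (nid X.1) (nid X.2) = nid (wedge X.1 X.2).
Proof. by apply: nhom_eq => p; apply: wedge_eq; case: p => -[]. Qed.

Lemma wedge_mapM (X Y W : prodc (projn A) (projn A))
    (g : hom Y W) (f : hom X Y) :
  wedge_map (ncomp g.1 f.1) (ncomp g.2 f.2) =
  ncomp (wedge_map g.1 g.2) (wedge_map f.1 f.2).
Proof. by apply: nhom_eq => p; apply: wedge_eq. Qed.

Definition wedge_functor : functor (prodc (projn A) (projn A)) (projn A) :=
  @Functor (prodc (projn A) (projn A)) (projn A) (fun X => pwedge X.1 X.2)
    (fun X Y f => wedge_map f.1 f.2) wedge_map1 wedge_mapM.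

Definition niso (M N : projn A) (f : mhom M N) (g : mhom N M)
    (fK : cancel f g) (gK : cancel g f) : @iso (projn A) M N :=
  @Iso (projn A) M N (NHom (inj_normal (can_inj fK)))
    (NHom (inj_normal (can_inj gK)))
    (nhom_eq (f := ncomp (NHom (inj_normal (can_inj gK)))
                         (NHom (inj_normal (can_inj fK))))
             (g := nid M) fK)
    (nhom_eq (f := ncomp (NHom (inj_normal (can_inj fK)))
                         (NHom (inj_normal (can_inj gK))))
             (g := nid N) gK).

Lemma assoc_subproof1 M N L (p : wedge (wedge M N) L) :
  (sval (sval p).1).2 = base N \/ (sval p).2 = base L.
Proof. by case: (svalP p) => /= ->; [left|right]. Qed.

Lemma assoc_subproof2 M N L (p : wedge (wedge M N) L) :
  (sval (sval p).1).1 = base M \/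
  exist _ ((sval (sval p).1).2, (sval p).2) (assoc_subproof1 p) =
    base (wedge N L).
Proof.
case: (svalP p) => /= p0; first by left; rewrite p0.
case: (svalP (sval p).1) => /= p1; first by left.
by right; apply: wedge_eq; rewrite /= p0 p1.
Qed.

Definition assoc_fun M N L (p : wedge (wedge M N) L) : wedge M (wedge N L) :=
  exist _ ((sval (sval p).1).1,
           exist _ ((sval (sval p).1).2, (sval p).2) (assoc_subproof1 p))
        (assoc_subproof2 p).

Lemma assoc_inv_subproof1 M N L (p : wedge M (wedge N L)) :
  (sval p).1 = base M \/ (sval (sval p).2).1 = base N.
Proof. by case: (svalP p) => /= ->; [left|right]. Qed.

Lemma assoc_inv_subproof2 M N L (p : wedge M (wedge N L)) :
  exist _ ((sval p).1, (sval (sval p).2).1) (assoc_inv_subproof1 p) =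
    base (wedge M N) \/
  (sval (sval p).2).2 = base L.
Proof.
case: (svalP p) => /= p0; last by right; rewrite p0.
case: (svalP (sval p).2) => /= p1; last by right.
by left; apply: wedge_eq; rewrite /= p0 p1.
Qed.

Definition assoc_inv_fun M N L (p : wedge M (wedge N L)) :
    wedge (wedge M N) L :=
  exist _ (exist _ ((sval p).1, (sval (sval p).2).1) (assoc_inv_subproof1 p),
           (sval (sval p).2).2)
        (assoc_inv_subproof2 p).

Lemma assoc_fun_base M N L :
  assoc_fun (base (wedge (wedge M N) L)) = base (wedge M (wedge N L)).
Proof. by do 2![apply: wedge_eq; congr pair]. Qed.

Lemma assoc_fun_act M N L a (p : wedge (wedge M N) L) :
  assoc_fun (act a p) = act a (assoc_fun p).
Proof. by do 2![apply: wedge_eq; congr pair]. Qed.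

Lemma assoc_inv_fun_base M N L :
  assoc_inv_fun (base (wedge M (wedge N L))) = base (wedge (wedge M N) L).
Proof. by do 2![apply: wedge_eq; congr pair]. Qed.

Lemma assoc_inv_fun_act M N L a (p : wedge M (wedge N L)) :
  assoc_inv_fun (act a p) = act a (assoc_inv_fun p).
Proof. by do 2![apply: wedge_eq; congr pair]. Qed.

Lemma assoc_funK M N L : cancel (@assoc_fun M N L) (@assoc_inv_fun M N L).
Proof.
by move=> [[[[m n] h] l] k]; do 2![apply: wedge_eq => //=; congr pair].
Qed.

Lemma assoc_inv_funK M N L : cancel (@assoc_inv_fun M N L) (@assoc_fun M N L).
Proof.
by move=> [[m [[n l] h]] k]; do 2![apply: wedge_eq => //=; congr pair].
Qed.

Definition wedge_assoc M N L :
    iso (pwedge (pwedge M N) L) (pwedge M (pwedge N L)) :=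
  @niso (pwedge (pwedge M N) L) (pwedge M (pwedge N L))
    (MHom (assoc_fun_base M N L) (@assoc_fun_act M N L))
    (MHom (assoc_inv_fun_base M N L) (@assoc_inv_fun_act M N L))
    (@assoc_funK M N L) (@assoc_inv_funK M N L).

Definition wedge_fst M N : mhom (wedge M N) M :=
  @MHom A (wedge M N) M (fun p => (sval p).1) erefl (fun _ _ => erefl).

Definition wedge_snd M N : mhom (wedge M N) N :=
  @MHom A (wedge M N) N (fun p => (sval p).2) erefl (fun _ _ => erefl).

Definition wedge_inl_fun M N (m : M) : wedge M N :=
  exist _ (m, base N) (or_intror erefl).

Definition wedge_inr_fun M N (n : N) : wedge M N :=
  exist _ (base M, n) (or_introl erefl).

Lemma wedge_inl_act M N a (m : M) :
  wedge_inl_fun N (act a m) = act a (wedge_inl_fun N m).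
Proof. by apply: wedge_eq; rewrite /= act_base. Qed.

Lemma wedge_inr_act M N a (n : N) :
  wedge_inr_fun M (act a n) = act a (wedge_inr_fun M n).
Proof. by apply: wedge_eq; rewrite /= act_base. Qed.

Lemma wedge_inl_base M N : wedge_inl_fun N (base M) = base (wedge M N).
Proof. exact: wedge_eq. Qed.

Lemma wedge_inr_base M N : wedge_inr_fun M (base N) = base (wedge M N).
Proof. exact: wedge_eq. Qed.

Definition wedge_inl M N : mhom M (wedge M N) :=
  MHom (wedge_inl_base M N) (@wedge_inl_act M N).

Definition wedge_inr M N : mhom N (wedge M N) :=
  MHom (wedge_inr_base M N) (@wedge_inr_act M N).

Local Notation Z0 := (zob (projn_zero A)).

Lemma wedge_sndK M : cancel (wedge_snd Z0 M) (wedge_inr Z0 M).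
Proof. by move=> [[[] m] h]; apply: wedge_eq. Qed.

Lemma wedge_inrK M : cancel (wedge_inr Z0 M) (wedge_snd Z0 M).
Proof. by []. Qed.

Lemma wedge_fstK M : cancel (wedge_fst M Z0) (wedge_inl M Z0).
Proof. by move=> [[m []] h]; apply: wedge_eq. Qed.

Lemma wedge_inlK M : cancel (wedge_inl M Z0) (wedge_fst M Z0).
Proof. by []. Qed.

Definition wedge_lunit M : iso (pwedge Z0 M) M :=
  @niso (pwedge Z0 M) M _ _ (@wedge_sndK M) (@wedge_inrK M).

Definition wedge_runit M : iso (pwedge M Z0) M :=
  @niso (pwedge M Z0) M _ _ (@wedge_fstK M) (@wedge_inlK M).

Lemma swap_subproof M N (p : wedge M N) :
  (sval p).2 = base N \/ (sval p).1 = base M.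
Proof. by case: (svalP p); [right|left]. Qed.

Definition swap_fun M N (p : wedge M N) : wedge N M :=
  exist _ ((sval p).2, (sval p).1) (swap_subproof p).

Lemma swap_fun_base M N : swap_fun (base (wedge M N)) = base (wedge N M).
Proof. exact: wedge_eq. Qed.

Lemma swap_fun_act M N a (p : wedge M N) :
  swap_fun (act a p) = act a (swap_fun p).
Proof. exact: wedge_eq. Qed.

Definition swap M N : mhom (wedge M N) (wedge N M) :=
  MHom (swap_fun_base M N) (@swap_fun_act M N).

Lemma swapK M N : cancel (swap M N) (swap N M).
Proof. by move=> [[m n] h]; apply: wedge_eq. Qed.

Definition wedge_braid M N : iso (pwedge M N) (pwedge N M) :=
  @niso (pwedge M N) (pwedge N M) _ _ (@swapK M N) (@swapK N M).

Definition wedge_tensor : tensor_data Z0 :=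
  @TensorData (projn A) Z0 wedge_functor wedge_assoc wedge_lunit wedge_runit
    wedge_braid.

End Wedge.

Section Dual.
Variables (A : pointedMonoidType) (sigma : A -> A) (eps : A).
Hypothesis cancA : right_partially_cancellative A.
Hypothesis sigmaP : pm_involution sigma.
Hypothesis eps_central : forall a : A, commute eps a.

Implicit Types M N : module A.

Lemma dual_base_normal M : normal (mcomp (mfrom0 (regular A)) (mto0 M)).
Proof. by move=> n n0 x y /esym/n0. Qed.

Definition dual_base M : nhom M (regular A) := NHom (@dual_base_normal M).

Definition dual_act_fun M (a : A) (f : nhom M (regular A)) (m : M) :
  regular A := (f m : A) * sigma a.

Lemma dual_act_fun_base M a (f : nhom M (regular A)) :
  dual_act_fun a f (base M) = base (regular A).
Proof. by rewrite /dual_act_fun mfun_base; exact: pzero_mul. Qed.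

Lemma dual_act_fun_act M a (f : nhom M (regular A)) b m :
  dual_act_fun a f (act b m) = act b (dual_act_fun a f m).
Proof. by rewrite /dual_act_fun mfun_act /= mulgA. Qed.

Lemma dual_act_normal M a (f : nhom M (regular A)) :
  normal (MHom (dual_act_fun_base a f) (dual_act_fun_act a f)).
Proof.
move=> n n0 x y /= xn yn.
have fxy_sigma : (f x : A) * sigma a = (f y : A) * sigma a.
  by rewrite -[LHS]/(dual_act_fun a f x) xn -yn.
case: (cancA fxy_sigma) => [fxy|[x0 _]].
  apply: (@normalE _ _ _ f x y fxy) => fx0; apply: n0.
  by rewrite -xn /= /dual_act_fun fx0; exact: pzero_mul.
by case: n0; rewrite -xn; exact: x0.
Qed.

Definition dual_act M (a : A) (f : nhom M (regular A)) :
  nhom M (regular A) := NHom (@dual_act_normal M a f).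

Lemma dual_act_base M a : dual_act a (dual_base M) = dual_base M.
Proof. by apply: nhom_eq => m; exact: pzero_mul. Qed.

Lemma dual_act0 M (f : nhom M (regular A)) : dual_act 0 f = dual_base M.
Proof.
apply: nhom_eq => m; rewrite /= /dual_act_fun (invol0 sigmaP).
exact: mul_pzero.
Qed.

Lemma dual_act1 M (f : nhom M (regular A)) : dual_act 1 f = f.
Proof.
by apply: nhom_eq => m; rewrite /= /dual_act_fun (invol1 sigmaP) mulg1.
Qed.

Lemma dual_actM M a b (f : nhom M (regular A)) :
  dual_act (a * b) f = dual_act a (dual_act b f).
Proof.
by apply: nhom_eq => m; rewrite /= /dual_act_fun (involM sigmaP) mulgA.
Qed.

Definition dual M : module A :=
  @Module A (nhom M (regular A)) (dual_base M) (@dual_act M)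
    (@dual_act_base M) (@dual_act0 M) (@dual_act1 M) (@dual_actM M).

Lemma precomp_base M N (f : nhom M N) :
  ncomp (base (dual N)) f = base (dual M).
Proof. exact: nhom_eq. Qed.

Lemma precomp_act M N (f : nhom M N) a (g : dual N) :
  ncomp (act a g) f = act a (ncomp g f : dual M).
Proof. exact: nhom_eq. Qed.

Definition precomp M N (f : nhom M N) : mhom (dual N) (dual M) :=
  @MHom A (dual N) (dual M) (fun g => ncomp g f)
    (precomp_base f) (precomp_act f).

Definition theta_fun M (m : M) (f : dual M) : regular A :=
  eps * sigma (f m).

Lemma theta_fun_base M (m : M) :
  theta_fun m (base (dual M)) = base (regular A).
Proof. by rewrite /theta_fun (invol0 sigmaP); exact: mul_pzero. Qed.

Lemma theta_fun_act M (m : M) a (f : dual M) :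
  theta_fun m (act a f) = act a (theta_fun m f).
Proof.
rewrite /theta_fun /= /dual_act_fun (involM sigmaP) (involK sigmaP).
by rewrite !mulgA eps_central.
Qed.

Definition theta_at M (m : M) : mhom (dual M) (regular A) :=
  MHom (theta_fun_base m) (theta_fun_act m).

Section Theta.
Variable M : module A.
Hypothesis theta_at_normal : forall m : M, normal (theta_at m).

Definition theta_map (m : M) : dual (dual M) := NHom (@theta_at_normal m).

Lemma theta_map_base : theta_map (base M) = base (dual (dual M)).
Proof.
apply: nhom_eq => f; rewrite /= /theta_fun mfun_base (invol0 sigmaP).
exact: mul_pzero.
Qed.

Lemma theta_map_act a (m : M) : theta_map (act a m) = act a (theta_map m).
Proof.
apply: nhom_eq => f; rewrite /= /theta_fun /dual_act_fun /= mfun_act.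
by rewrite (involM sigmaP) mulgA.
Qed.

Definition theta : mhom M (dual (dual M)) :=
  MHom theta_map_base theta_map_act.

End Theta.

(* The closure properties under which [dual], [precomp] and [theta] define
   objects and morphisms of [projn]; [dual_functor] and [Theta] below take a
   proof of them. *)
Record duality_well_defined : Prop := {
  dual_fg_projective : forall M : projn A, fg_projective (dual M);
  precomp_normal : forall (M N : projn A) (f : nhom M N), normal (precomp f);
  theta_at_normal : forall (M : projn A) (m : M), normal (theta_at m);
  theta_normal : forall M : projn A, normal (theta (@theta_at_normal M))
}.

Section DualityFunctor.
Hypothesis wd : duality_well_defined.

Definition dual_projmod (M : projn A) : projn A :=
  ProjMod (dual_fg_projective wd M).

Definition dual_fmap (M N : projn A) (f : nhom M N) :
    nhom (dual_projmod N) (dual_projmod M) :=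
  NHom (@precomp_normal wd M N f).

Lemma dual_fmap1 (M : projn A) : dual_fmap (nid M) = nid (dual_projmod M).
Proof. by apply: nhom_eq => g; apply: nhom_eq. Qed.

Lemma dual_fmapM (M N L : projn A) (g : nhom N L) (f : nhom M N) :
  dual_fmap (ncomp g f) = ncomp (dual_fmap f) (dual_fmap g).
Proof. by apply: nhom_eq => h; apply: nhom_eq. Qed.

Definition dual_functor : functor (op (projn A)) (projn A) :=
  @Functor (op (projn A)) (projn A) dual_projmod
    (fun X Y (f : nhom (Y : projn A) (X : projn A)) => dual_fmap f)
    dual_fmap1 (fun X Y W g f => dual_fmapM f g).

Definition Theta (M : projn A) :
    @hom (projn A) M (dual_functor (dual_functor M)) :=
  NHom (@theta_normal wd M).

End DualityFunctor.
End Dual.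

(* Main.v *)
(* In A-proj^n the inflations are exactly the split monomorphisms and the
   deflations exactly the split epimorphisms: a normal homomorphism with a
   one-sided inverse cuts its source or target into a wedge of two projective
   pieces.  Hence every functor preserves both classes, and a commutative
   square of inflations i, j and deflations p, q with q i = j p is cartesian,
   equivalently cocartesian, exactly when ker q lies in the image of i.  None of
   this, nor unique splitting and combinatoriality, uses the hypotheses on A.

   Those enter through duality.  Partial cancellation forces the idempotents of
   A to be 0 and 1, so each finitely generated projective module M has a finite
   basis, with coordinate maps M -> A.  By reversibility a normal homomorphism
   M -> A is nonzero on exactly one basis vector or vanishes, so it is a
   multiple of one coordinate map: the coordinate maps form a basis of the dual,
   and two elements of the dual that agree at some point with a nonzero value
   are equal. *)
Require Import Defs.
From mathcomp Require Import ssreflect ssrfun ssrbool eqtype choice monoid.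
From mathcomp Require Import ssrnat fintype boolp.

Set Implicit Arguments.
Unset Strict Implicit.
Unset Printing Implicit Defensive.

Local Open Scope group_scope.

(** * Summands, kernels and cokernels *)

Section Summands.
Variable A : pointedMonoidType.
Implicit Types M N L : module A.

(** Both points have the same image under [r], which is not the base point, so normality identifies
    them. Off its kernel, a normal homomorphism with a section is thus inverted by that section;
    most splittings below rest on this. *)
Lemma cancel_normal M N (i : M -> N) (r : nhom N M) :
  cancel i r -> forall n, r n <> base M -> i (r n) = n.
Proof. by move=> ir n n0; apply: (@normalE _ _ _ r); rewrite ir. Qed.

(** Generators are pushed forward along [r]; a lifting problem for [N] is pulled back to [M] along
    [r], and its solution is restricted along [i]. *)
Lemma fg_projective_retract M N (i : mhom N M) (r : mhom M N) :
  cancel i r -> fg_projective M -> fg_projective N.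
Proof.
move=> ir [[n [g gP]] projM]; split.
  exists n, (r \o g) => y; have [y0|[k [a ya]]] := gP (i y).
    by left; rewrite -(ir y) y0 mfun_base.
  by right; exists k, a; rewrite /= -mfun_act -ya ir.
move=> L L' q f /(projM _ _ q (mcomp f r))[h qh].
exists (mcomp h i); apply: mhom_eq => y.
by rewrite -[LHS]/(mcomp q h (i y)) qh /= ir.
Qed.

(* Equivalently, M is the wedge of S and another submodule. *)
Record summand M (S : M -> Prop) : Prop := {
  summand_base : S (base M);
  summand_act : forall a m, S m -> S (act a m);
  summand_off : forall a m, ~ S m -> S (act a m) -> act a m = base M
}.

Section Summand.
Variables (M : module A) (S : M -> Prop).
Hypothesis SP : summand S.

Let car := {m : M | S m}.
Let sbase : car := exist S (base M) (summand_base SP).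
Let sact a (m : car) : car := exist S _ (summand_act SP a (svalP m)).

Lemma summand_eq (x y : {m : M | S m}) : sval x = sval y -> x = y.
Proof.
case: x y => [x hx] [y hy] /= xy; case: _ / xy hy => hy.
by congr exist; exact: Prop_irrelevance.
Qed.

Let sact_base a : sact a sbase = sbase.
Proof. by apply: summand_eq; rewrite /= act_base. Qed.
Let sact0 m : sact 0 m = sbase.
Proof. by apply: summand_eq; rewrite /= act0. Qed.
Let sact1 m : sact 1 m = m.
Proof. by apply: summand_eq; rewrite /= act1. Qed.
Let sactM a b m : sact (a * b) m = sact a (sact b m).
Proof. by apply: summand_eq; rewrite /= actM. Qed.

Definition summand_module : module A :=
  @Module A car sbase sact sact_base sact0 sact1 sactM.

Definition summand_incl_hom : mhom summand_module M :=
  @MHom A summand_module M sval erefl (fun _ _ => erefl).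

Definition summand_incl : nhom summand_module M :=
  NHom (@inj_normal A _ _ summand_incl_hom summand_eq).

(** Everything outside the summand is collapsed to the base point; [summand_off] makes this
    compatible with the action. *)
Let retr_fun (m : M) : summand_module :=
  if pselect (S m) is left h then exist S m h else sbase.

Let retr_base : retr_fun (base M) = base summand_module.
Proof.
by rewrite /retr_fun; case: pselect => //= h; apply: summand_eq.
Qed.

Let retr_act a m : retr_fun (act a m) = act a (retr_fun m).
Proof.
rewrite /retr_fun; case: pselect => Sam; case: pselect => Sm;
  apply: summand_eq => //=.
- by rewrite act_base (summand_off SP Sm Sam).
- by case: Sam; apply: (summand_act SP).
- by rewrite act_base.
Qed.

Let retr_normal : normal (MHom retr_base retr_act).
Proof.
move=> n n0 x y /=; rewrite /retr_fun.
case: pselect => [Sx|_] xn; last by case: n0; rewrite -xn.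
case: pselect => [Sy|_] yn; last by case: n0; rewrite -yn.
by have /(congr1 sval) := etrans xn (esym yn).
Qed.

Definition summand_retr : nhom M summand_module := NHom retr_normal.

Lemma summand_inclK : cancel summand_incl summand_retr.
Proof.
move=> [m Sm] /=; rewrite /retr_fun; case: pselect => // S'm.
exact: summand_eq.
Qed.

Lemma summand_retrK m : S m -> summand_incl (summand_retr m) = m.
Proof. by rewrite /= /retr_fun; case: pselect. Qed.

Lemma summand_retr_off m : ~ S m -> summand_retr m = base summand_module.
Proof. by rewrite /= /retr_fun; case: pselect. Qed.

End Summand.
Arguments summand_inclK {M S} SP _.

(** A point [m] outside the kernel equals [s (p m)], so a multiple of it killed by [p] is the image
    under [s] of the base point. *)
Lemma kernel_summand M N (p : nhom M N) (s : nhom N M) :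
  cancel s p -> summand (fun m => p m = base N).
Proof.
move=> sp; split=> [|a m pm|a m pm pam]; first exact: mfun_base.
  by rewrite mfun_act pm act_base.
by rewrite -(cancel_normal sp pm) -mfun_act -mfun_act pam mfun_base.
Qed.

(** * Kernels of split epimorphisms as cokernels of their sections *)

Section SplitEpi.
Variables (M N : module A) (p : nhom M N) (s : nhom N M).
Hypothesis sp : cancel s p.

Definition split_kernel : module A := summand_module (kernel_summand sp).
Definition split_kernel_incl : nhom split_kernel M :=
  summand_incl (kernel_summand sp).
Definition split_kernel_retr : nhom M split_kernel :=
  summand_retr (kernel_summand sp).

Lemma split_kernel_inclK : cancel split_kernel_incl split_kernel_retr.
Proof. exact: summand_inclK. Qed.

Lemma split_kernelP m : p m = base N -> exists k, m = split_kernel_incl k.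
Proof.
by move=> pm; exists (split_kernel_retr m); rewrite [RHS]summand_retrK.
Qed.

Lemma split_kernel_incl0 k : p (split_kernel_incl k) = base N.
Proof. exact: (svalP k). Qed.

Lemma split_cokernel_retr0 n : split_kernel_retr (s n) = base split_kernel.
Proof.
have [n0|n0] := pselect (n = base N); first by rewrite n0 !mfun_base.
by apply: summand_retr_off; rewrite sp.
Qed.

(** A point outside the kernel of [p] is recovered by [s]; one inside is kept by the retraction,
    hence is the base point. *)
Lemma split_cokernelP m :
  split_kernel_retr m = base split_kernel -> s (p m) = m.
Proof.
have [pm|pm] := pselect (p m = base N); last by rewrite cancel_normal.
move=> /(congr1 sval); rewrite [LHS]summand_retrK //= => ->.
by rewrite !mfun_base.
Qed.

Lemma split_kernel_is_kernel :
  @is_kernel (modcat A) (modcat_zero A) split_kernel M N split_kernel_incl p.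
Proof.
split; first by apply: mhom_eq; exact: split_kernel_incl0.
move=> T t pt.
have ptx x : p (t x) = base N by rewrite -[LHS]/(mcomp p t x) [mcomp p t]pt.
exists (mcomp split_kernel_retr t); split.
  by apply: mhom_eq => x; rewrite [LHS]summand_retrK.
move=> u <-; apply: mhom_eq => x; exact: split_kernel_inclK.
Qed.

(** [M] is the wedge of the image of [s] and the kernel of [p], so a homomorphism killing the former
    is determined by its restriction to the latter. *)
Lemma split_kernel_is_cokernel :
  @is_cokernel (modcat A) (modcat_zero A) N M split_kernel split_kernel_retr s.
Proof.
split; first by apply: mhom_eq; exact: split_cokernel_retr0.
move=> T t ts.
have tsx x : t (s x) = base T by rewrite -[LHS]/(mcomp t s x) [mcomp t s]ts.
exists (mcomp t split_kernel_incl); split; last first.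
  by move=> u <-; apply: mhom_eq => x; exact: (congr1 u (split_kernel_inclK x)).
apply: mhom_eq => x; have [px|px] := pselect (p x = base N).
  by congr (t _); rewrite [LHS]summand_retrK.
rewrite -(cancel_normal sp px) tsx.
rewrite -[LHS]/(t (split_kernel_incl (split_kernel_retr (s (p x))))).
by rewrite split_cokernel_retr0 !mfun_base.
Qed.

End SplitEpi.
Arguments split_kernel_inclK {M N p s} sp _.

(** * Quotients by the image of a homomorphism *)

Section Quotient.
Variables (M N : module A) (i : mhom M N).

Let im n := exists m, i m = n.
(* The classes are represented by the points outside the image of [i]. *)
Let car := {n : N | im n -> n = base N}.

Let quo_subproof n : ~ im n -> im n -> n = base N. Proof. by []. Qed.
Let qbase : car := exist _ (base N) (fun _ => erefl).
Let quo n : car :=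
  if pselect (im n) is right h then exist _ n (quo_subproof h) else qbase.

Let im_act a n : im n -> im (act a n).
Proof. by move=> [m <-]; exists (act a m); rewrite mfun_act. Qed.

Let car_eq (x y : car) : sval x = sval y -> x = y.
Proof.
case: x y => [x hx] [y hy] /= xy; case: _ / xy hy => hy.
by congr exist; exact: Prop_irrelevance.
Qed.

Let quo_act a n : quo (act a (sval (quo n))) = quo (act a n).
Proof.
rewrite {2}/quo; case: pselect => //= imn; rewrite act_base /quo.
case: pselect => [_|h]; last by case: h; exists (base M); rewrite mfun_base.
by case: pselect => // h; case: h; apply: im_act.
Qed.

Let quo_val (x : car) : quo (sval x) = x.
Proof.
case: x => n h; rewrite /quo /=; case: pselect => [imn|h']; apply: car_eq => //=.
by rewrite h.
Qed.

Let qact a (x : car) : car := quo (act a (sval x)).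

Let quo_base : quo (base N) = qbase. Proof. exact: (quo_val qbase). Qed.

Let qact_base a : qact a qbase = qbase.
Proof. by rewrite /qact /= act_base quo_base. Qed.
Let qact0 m : qact 0 m = qbase.
Proof. by rewrite /qact /= act0 quo_base. Qed.
Let qact1 m : qact 1 m = m.
Proof. by rewrite /qact /= act1 quo_val. Qed.
Let qactM a b m : qact (a * b) m = qact a (qact b m).
Proof. by rewrite /qact quo_act actM. Qed.

Definition quotient : module A :=
  @Module A car qbase qact qact_base qact0 qact1 qactM.

Definition quotient_map : mhom N quotient :=
  @MHom A N quotient quo quo_base (fun a n => esym (quo_act a n)).

Lemma quotient_map0 m : quotient_map (i m) = base quotient.
Proof. by rewrite /= /quo; case: pselect => // h; case: h; exists m. Qed.

Lemma quotient_mapP n n' : quotient_map n = quotient_map n' ->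
  n = n' \/ (exists m, i m = n) /\ (exists m, i m = n').
Proof.
rewrite /= /quo; case: pselect => h; case: pselect => h' /(congr1 sval) /= e.
- by right.
- by case: h'; rewrite -e; exists (base M); rewrite mfun_base.
- by case: h; rewrite e; exists (base M); rewrite mfun_base.
- by left.
Qed.

Lemma quotient_lift T (t : mhom N T) : (forall m, t (i m) = base T) ->
  exists u : mhom quotient T, mcomp u quotient_map = t.
Proof.
move=> ti; have tq n : t (sval (quo n)) = t n.
  by rewrite /quo; case: pselect => // -[m <-] /=; rewrite mfun_base ti.
have ub : t (sval (base quotient)) = base T by rewrite /= mfun_base.
have ua a (x : quotient) : t (sval (act a x)) = act a (t (sval x)).
  by rewrite /= tq mfun_act.
by exists (@MHom A quotient T (fun x => t (sval x)) ub ua); apply: mhom_eq.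
Qed.

(** A cokernel is known only through its universal property; comparing it with the explicit quotient
    reveals its fibres and its surjectivity. *)
Lemma cokernel_fibers Q (c : mhom N Q) :
  @is_cokernel (modcat A) (modcat_zero A) M N Q c i ->
  surjective c /\ forall n n', c n = c n' ->
    n = n' \/ (exists m, i m = n) /\ (exists m, i m = n').
Proof.
move=> [ci0 cU].
have [|u [uc _]] := cU quotient quotient_map.
  by apply: mhom_eq; exact: quotient_map0.
have {}uc n : u (c n) = quotient_map n by rewrite -uc.
split; last by move=> n n' cnn'; apply: quotient_mapP; rewrite -!uc cnn'.
have [v vq] : exists v : mhom quotient Q, mcomp v quotient_map = c.
  apply: quotient_lift => m.
  by rewrite -[LHS]/(mcomp c i m) [mcomp c i]ci0.
have [w [_ wU]] := cU Q c ci0.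
(* Both [mcomp v u] and the identity factor [c] through [c], so the uniqueness clause identifies
   them. *)
have vu : mcomp v u = mid Q.
  rewrite -(wU (mid Q)); last exact: mcomp1m.
  apply/esym/wU; apply: mhom_eq => n; rewrite -[LHS]/(v (u (c n))) uc.
  by rewrite -[LHS]/(mcomp v quotient_map n) vq.
move=> q; exists (sval (u q)).
by rewrite -vq /= [quo _]quo_val -[LHS]/(mcomp v u q) vu.
Qed.

End Quotient.

End Summands.
Arguments summand_inclK {A M S} SP _.
Arguments split_kernel_inclK {A M N p s} sp _.

(** * The proto-exact structure *)

Section ProtoExact.
Variable A : pointedMonoidType.
Implicit Types X Y U V W : projn A.
Local Notation E := (projn_classes A).
Local Notation Z := (projn_zero A).

(** A retraction [r] is a split epimorphism with section [i], so its kernel is the cokernel of [i].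
    Conversely, projectivity of the cokernel splits [c], and this splitting shows that collapsing
    the complement of the image of [i] is equivariant. *)
Lemma inflationP X Y (i : nhom X Y) :
  inflation E i <-> exists r : nhom Y X, cancel i r.
Proof.
split=> [[iI [Q [c [[_ projQ] cokc]]]]|[r ir]]; last first.
  split; first exact: (can_inj ir).
  exists (split_kernel ir), (split_kernel_retr ir); split.
    exact: (fg_projective_retract (split_kernel_inclK ir) (projmodP Y)).
  exact: split_kernel_is_cokernel.
have [cS cE] := cokernel_fibers cokc.
have [h ch] := projQ _ _ c (mid Q) cS.
have {}ch q : c (h q) = q by rewrite -[LHS]/(mcomp c h q) ch.
have ci x : c (i x) = base Q.
  by case: cokc => ci _; rewrite -[LHS]/(mcomp c i x) [mcomp c i]ci.
pose r_fun y : X := if pselect (exists x, i x = y) is left e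
  then sval (cid e) else base X.
have r_i x : r_fun (i x) = x.
  rewrite /r_fun; case: pselect => [e|[]]; last by exists x.
  by apply: iI; exact: (svalP (cid e)).
have r_off y : (forall x, i x <> y) -> r_fun y = base X.
  by rewrite /r_fun => yN; case: pselect => // -[x xy]; case: (yN x).
have r_act a y : r_fun (act a y) = act a (r_fun y).
  have [[x <-]|yN] := pselect (exists x, i x = y).
    by rewrite -mfun_act !r_i.
  rewrite (r_off y) ?act_base; last by move=> x xy; apply: yN; exists x.
  have [[x xay]|ayN] := pselect (exists x, i x = act a y); last first.
    by rewrite r_off // => x xy; apply: ayN; exists x.
  (* Off the image of [i] the fibres of [c] are singletons, so [y = h (c y)]. Hence [act a y], being
     in the image of [i] and so killed by [c], is the base point. *)
  have [y_hcy|[_ //]] := cE (h (c y)) y (ch _).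
  rewrite -y_hcy -!mfun_act -xay ci mfun_base -(mfun_base i).
  exact: r_i.
have r_base : r_fun (base Y) = base X by rewrite -(mfun_base i) r_i.
have r_normal : normal (MHom r_base r_act).
  move=> n n0; suff iN y : r_fun y = n -> i n = y by move=> x y /iN <- /iN.
  rewrite /r_fun; case: pselect => [e <-|_ n0']; last by case: n0.
  exact: (svalP (cid e)).
by exists (NHom r_normal) => x; exact: r_i.
Qed.

(** Projectivity of [Y] gives a section, which is injective and therefore normal. *)
Lemma surjective_split X Y (p : nhom X Y) :
  surjective p -> exists s : nhom Y X, cancel s p.
Proof.
move=> pS; have [_ projY] := projmodP Y.
have [s ps] := projY _ _ p (mid Y) pS.
have sp : cancel s p by move=> y; rewrite -[LHS]/(mcomp p s y) ps.
by exists (NHom (inj_normal (can_inj sp))).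
Qed.

Lemma deflationP X Y (p : nhom X Y) :
  deflation E p <-> exists s : nhom Y X, cancel s p.
Proof.
split=> [[/surjective_split //]|[s sp]].
split; first by move=> y; exists (s y); rewrite sp.
exists (split_kernel sp), (split_kernel_incl sp); split.
  exact: (fg_projective_retract (split_kernel_inclK sp) (projmodP X)).
exact: split_kernel_is_kernel.
Qed.

Lemma nhomE (M N : module A) (f g : nhom M N) : f = g -> f =1 g.
Proof. by move=> ->. Qed.

Lemma is_iso_nhom X Y (f : nhom X Y) :
  @is_iso (projn A) X Y f <-> exists g : nhom Y X, cancel f g /\ cancel g f.
Proof.
split=> [[g [gf fg]]|[g [fK gK]]].
  by exists g; split=> x; [exact: (nhomE gf x)|exact: (nhomE fg x)].
by exists g; split; apply: nhom_eq => x; [exact: fK|exact: gK].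
Qed.

Definition kernel_proj X Y (p : nhom X Y) (s : nhom Y X) (sp : cancel s p) :
    projn A :=
  ProjMod (fg_projective_retract (split_kernel_inclK sp) (projmodP X)).

(** * Bicartesian squares and the kernel criterion *)

Section Squares.
Variables U X W V : projn A.
Variables (i : nhom U X) (p : nhom U W) (q : nhom X V) (j : nhom W V).
Hypothesis sq : @exact_square (projn A) E U X W V i p q j.

Definition kernel_in_image := forall x, q x = base V -> exists u, i u = x.

Let sqE u : q (i u) = j (p u).
Proof. by case: sq => _ _ _ _ /nhomE/(_ u). Qed.

Lemma cartesian_kernel_in_image :
  @cartesian (projn A) U X W V i p q j <-> kernel_in_image.
Proof.
have [/inflationP[r ir] /inflationP[r' jr'] /deflationP[s sp]
  /deflationP[t tq] _] := sq.
split=> [cart x /(split_kernelP tq)[k ->]|qK].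
  (* The test object is the kernel of [q], mapped to [X] by inclusion and to [W] by zero. *)
  have [|u [[iu _] _]] := cart (kernel_proj tq) (split_kernel_incl tq)
    (ncomp (from0 Z W) (to0 Z (kernel_proj tq))).
    by apply: nhom_eq => x'; rewrite /= mfun_base; exact: split_kernel_incl0.
  by exists (u k); exact: (nhomE iu k).
move=> T x w qx_jw.
have {}qx_jw y : q (x y) = j (w y) by exact: (nhomE qx_jw y).
have xU y : i (r (x y)) = x y.
  have [u <-] : exists u, i u = x y; last by rewrite ir.
  have [/qK//|qx] := pselect (q (x y) = base V).
  (* The candidate comes from lifting [w y] along [p]: then [q (i (s (w y))) = j (w y) = q (x y)],
     and normality of [q] applies. *)
  exists (s (w y)); apply: (@normalE _ _ _ q) => //.
    by rewrite sqE sp qx_jw.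
  by rewrite sqE sp -qx_jw.
exists (ncomp r x); split; first split; first exact: nhom_eq.
  apply: nhom_eq => y; apply: (can_inj jr').
  by rewrite -qx_jw -(xU y) sqE.
by move=> u [iu _]; apply: nhom_eq => y /=; rewrite -(nhomE iu y) /= ir.
Qed.

Lemma cocartesian_kernel_in_image :
  @cocartesian (projn A) U X W V i p q j <-> kernel_in_image.
Proof.
have [/inflationP[r ir] /inflationP[r' jr'] /deflationP[s sp]
  /deflationP[t tq] _] := sq.
split=> [cocart x qx|qK].
  (* The test object is the cokernel of [i], with the zero map from [W]. As the retraction factors
     through [q], it kills the kernel of [q]. *)
  have [|v [[vq _] _]] := cocart (kernel_proj ir) (split_kernel_retr ir)
    (ncomp (from0 Z (kernel_proj ir)) (to0 Z W)).
    by apply: nhom_eq => u; exact: (split_cokernel_retr0 ir).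
  exists (r x); apply: (split_cokernelP (sp := ir)).
  by rewrite -(nhomE vq x) /= qx mfun_base.
move=> T x w xi_wp.
have {}xi_wp u : x (i u) = w (p u) by exact: (nhomE xi_wp u).
(* The map [x] factors through [q]: off the kernel [t] inverts [q], and a point of the kernel comes
   from a [u] with [p u] trivial, where [x] vanishes. *)
have vq y : x (t (q y)) = x y.
  have [qy|qy] := pselect (q y = base V); last by rewrite (cancel_normal tq).
  have [u uy] := qK _ qy; rewrite qy !mfun_base -uy xi_wp.
  have ->: p u = base W.
    by apply: (can_inj jr'); rewrite -sqE uy qy mfun_base.
  by rewrite mfun_base.
exists (ncomp x t); split; first split; first exact: nhom_eq.
  apply: nhom_eq => y /=.
  by rewrite -[in LHS](sp y) -sqE vq xi_wp sp.
by move=> v [vq' _]; apply: nhom_eq => y /=; rewrite -(nhomE vq' _) /= tq.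
Qed.

Lemma admissible_kernel_in_image :
  @admissible_square (projn A) E U X W V i p q j <-> kernel_in_image.
Proof.
split=> [[_ /cartesian_kernel_in_image]//|qK].
split=> //; first exact/cartesian_kernel_in_image.
exact/cocartesian_kernel_in_image.
Qed.

End Squares.

Definition summand_proj X (S : X -> Prop) (SP : summand S) : projn A :=
  ProjMod (fg_projective_retract (summand_inclK SP) (projmodP X)).

(** This is the object of the pullback. If [q x] is not in the image of [j], the retraction [r]
    kills it, so any multiple of [q x] in that image is the base point; [t] carries this back to
    [x]. *)
Lemma preimage_summand X W V (q : nhom X V) (j : nhom W V) :
  deflation E q -> inflation E j -> summand (fun x => exists w, q x = j w).
Proof.
move=> /deflationP[t tq] /inflationP[r jr].
split=> [|a x [w qx]|a x qxN [w qax]].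
- by exists (base W); rewrite !mfun_base.
- by exists (act a w); rewrite !mfun_act qx.
have qx : q x <> base V.
  by move=> qx; apply: qxN; exists (base W); rewrite qx mfun_base.
have rqx : r (q x) = base W.
  apply: contrapT => /(cancel_normal jr) jrqx; apply: qxN.
  by exists (r (q x)).
rewrite -(cancel_normal tq qx) -mfun_act -mfun_act qax.
by rewrite -(jr w) -qax mfun_act mfun_act rqx act_base !mfun_base.
Qed.

(** This is the object of the pushout: the condition removes from [X] exactly the nonzero points of
    the image under [i] of the kernel of [p]. *)
Lemma pushout_summand U X W (i : nhom U X) (r : nhom X U) (p : nhom U W)
    (s : nhom W U) : cancel i r -> cancel s p ->
  summand (fun x => p (r x) = base W -> r x = base U).
Proof.
move=> ir sp; split=> [_|a x Sx|a x Sx Sax]; first exact: mfun_base.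
  rewrite !mfun_act; have [/Sx-> _|prx] := pselect (p (r x) = base W).
    exact: act_base.
  by move=> aprx; rewrite -(cancel_normal sp prx) -mfun_act aprx mfun_base.
have prx : p (r x) = base W by apply: contrapT => prx; apply: Sx.
have rx : r x <> base U by move=> rx; apply: Sx.
rewrite -(cancel_normal ir rx) -mfun_act -mfun_act Sax ?mfun_base //.
by rewrite !mfun_act prx act_base.
Qed.

Lemma projn_proto_exact : proto_exact Z E.
Proof.
split.
- move=> X; apply/inflationP; exists (to0 Z X); by case.
- move=> X; apply/deflationP; exists (from0 Z X); by case.
- move=> X Y f /is_iso_nhom[g [fK _]]; apply/inflationP; by exists g.
- move=> X Y f /is_iso_nhom[g [_ gK]]; apply/deflationP; by exists g.
- move=> X Y T g f /inflationP[r gr] /inflationP[r' fr].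
  apply/inflationP; exists (ncomp r' r); exact: can_comp.
- move=> X Y T g f /deflationP[r gr] /deflationP[r' fr].
  apply/deflationP; exists (ncomp r' r); exact: can_comp.
- move=> U X W V i p q j sq.
  by rewrite (cartesian_kernel_in_image sq) (cocartesian_kernel_in_image sq).
- move=> X W V q j dq ij; have SP := preimage_summand dq ij.
  have [/deflationP[t tq] /inflationP[r jr]] := (dq, ij).
  pose i : @hom (projn A) (summand_proj SP) X := summand_incl SP.
  (* Since [q (i u)] lies in the image of [j], the retraction [r] finds its preimage. *)
  pose p : @hom (projn A) (summand_proj SP) W := ncomp r (ncomp q i).
  have jp u : j (p u) = q (i u).
    by case: (svalP u) => w qu; rewrite /p /= qu jr.
  exists (summand_proj SP), i, p.
  have qU w : exists u, q (i u) = j w.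
    have Sjw : exists w', q (t (j w)) = j w' by exists w; rewrite tq.
    by exists (exist _ (t (j w)) Sjw); rewrite /= tq.
  have sq : @exact_square (projn A) E (summand_proj SP) X W V i p q j.
    split=> //.
    + by apply/inflationP; exists (summand_retr SP); exact: summand_inclK.
    + apply/deflationP/surjective_split => w.
      by have [u qu] := qU w; exists u; apply: (can_inj jr); rewrite jp.
    + by apply: nhom_eq => u; rewrite [RHS]jp.
  apply/(admissible_kernel_in_image sq) => x qx.
  have Sx : exists w, q x = j w by exists (base W); rewrite qx mfun_base.
  by exists (exist _ x Sx).
- move=> U X W i p /inflationP[r ir] /deflationP[s sp].
  have SP := pushout_summand ir sp.
  pose q : @hom (projn A) X (summand_proj SP) := summand_retr SP.
  pose j : @hom (projn A) W (summand_proj SP) := ncomp q (ncomp i s).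
  have qj w : sval (j w) = i (s w).
    by rewrite [LHS]summand_retrK // ir sp => ->; rewrite mfun_base.
  exists (summand_proj SP), q, j.
  have sq : @exact_square (projn A) E U X W (summand_proj SP) i p q j.
    split.
    + by apply/inflationP; exists r.
    + apply/inflationP; exists (ncomp p (ncomp r (summand_incl SP))) => w.
      by rewrite /= [sval _]qj ir sp.
    + by apply/deflationP; exists s.
    + by apply/deflationP; exists (summand_incl SP); exact: summand_inclK.
    + apply: nhom_eq => u.
      rewrite -[LHS]/(summand_retr SP (i u)).
      rewrite -[RHS]/(summand_retr SP (i (s (p u)))).
      (* If [p u] is not the base point, [s (p u)] is [u]; otherwise [i u] is trivial or one of the
         removed points, and the retraction collapses it. *)
      have [pu|pu] := pselect (p u = base W); last by rewrite (cancel_normal sp).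
      rewrite pu !mfun_base; have [->|u0] := pselect (u = base U).
        by rewrite !mfun_base.
      have SN : ~ (p (r (i u)) = base W -> r (i u) = base U).
        by rewrite ir => /(_ pu).
      exact: (summand_retr_off SP SN).
  apply/(admissible_kernel_in_image sq) => x qx; exists (r x).
  have [Sx|Sx] := pselect (p (r x) = base W -> r x = base U).
    by rewrite -(summand_retrK SP Sx) [summand_retr _ _]qx !mfun_base.
  apply: (cancel_normal ir) => rx; exact: Sx.
Qed.

End ProtoExact.

(** * The direct sum *)

Section DirectSum.
Variable A : pointedMonoidType.
Implicit Types M N L U V W X Y : projn A.
Local Notation E := (projn_classes A).
Local Notation Z := (projn_zero A).
Local Notation S := (wedge_tensor A).
Local Notation inl M N := (wedge_inl M N).
Local Notation inr M N := (wedge_inr M N).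

Lemma wedgeP M N (p : wedge M N) :
  (exists m, p = inl M N m) \/ (exists n, p = inr M N n).
Proof.
case: p => -[m n] [/= m0|/= n0]; [right; exists n|left; exists m];
  by apply: wedge_eq; rewrite /= ?m0 ?n0.
Qed.

Lemma wedge_inl_inj M N : injective (inl M N).
Proof. by move=> x y /(congr1 sval)[]. Qed.

Lemma wedge_inr_inj M N : injective (inr M N).
Proof. by move=> x y /(congr1 sval)[]. Qed.

Lemma wedge_fst_normal M N : normal (wedge_fst M N).
Proof.
move=> m m0 p q /= pm qm; apply: wedge_eq.
rewrite [sval p]surjective_pairing [sval q]surjective_pairing pm qm.
case: (svalP p) => [p0|->]; first by case: m0; rewrite -pm.
by case: (svalP q) => [q0|->]; first by case: m0; rewrite -qm.
Qed.

Lemma wedge_snd_normal M N : normal (wedge_snd M N).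
Proof.
have swap_normal : normal (swap M N).
  exact: (inj_normal (can_inj (@swapK A M N))).
exact: (normal_comp (@wedge_fst_normal N M) swap_normal).
Qed.

Definition nfst M N : nhom (wedge M N) M := NHom (@wedge_fst_normal M N).
Definition nsnd M N : nhom (wedge M N) N := NHom (@wedge_snd_normal M N).
Definition ninl M N : nhom M (wedge M N) :=
  NHom (inj_normal (@wedge_inl_inj M N)).
Definition ninr M N : nhom N (wedge M N) :=
  NHom (inj_normal (@wedge_inr_inj M N)).

Section Copair.
Variables (M N : projn A) (L : module A) (f : mhom M L) (g : mhom N L).

(** The copairing of normal homomorphisms need not be normal, so it is formed among all
    homomorphisms; normality is obtained later from injectivity. *)
Definition copair_fun (p : wedge M N) : L :=
  if pselect ((sval p).1 = base M) then g (sval p).2 else f (sval p).1.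

Lemma copair_fun_inl m : copair_fun (inl M N m) = f m.
Proof. by rewrite /copair_fun; case: pselect => //= ->; rewrite !mfun_base. Qed.

Lemma copair_fun_inr n : copair_fun (inr M N n) = g n.
Proof. by rewrite /copair_fun; case: pselect. Qed.

Lemma copair_fun_base : copair_fun (base _) = base L.
Proof. by rewrite -(mfun_base (inl M N)) copair_fun_inl mfun_base. Qed.

Lemma copair_fun_act a p : copair_fun (act a p) = act a (copair_fun p).
Proof.
case: (wedgeP p) => -[m ->]; rewrite -mfun_act.
  by rewrite !copair_fun_inl mfun_act.
by rewrite !copair_fun_inr mfun_act.
Qed.

Definition copair : mhom (wedge M N) L := MHom copair_fun_base copair_fun_act.

Lemma copair_inl m : copair (inl M N m) = f m.
Proof. exact: copair_fun_inl. Qed.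

Lemma copair_inr n : copair (inr M N n) = g n.
Proof. exact: copair_fun_inr. Qed.

End Copair.

Section Pair.
Variables (L : module A) (M N : projn A) (f : mhom L M) (g : mhom L N).
Hypothesis fg : forall x, f x = base M \/ g x = base N.

Let pair_fun x : wedge M N := exist _ (f x, g x) (fg x).
Let pair_base : pair_fun (base L) = base _.
Proof. by apply: wedge_eq; rewrite /= !mfun_base. Qed.
Let pair_act a x : pair_fun (act a x) = act a (pair_fun x).
Proof. by apply: wedge_eq; rewrite /= !mfun_act. Qed.

Definition wpair : mhom L (wedge M N) := MHom pair_base pair_act.

Lemma wpair_inl x : g x = base N -> wpair x = inl M N (f x).
Proof. by move=> gx; apply: wedge_eq; rewrite /= gx. Qed.

Lemma wpair_inr x : f x = base M -> wpair x = inr M N (g x).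
Proof. by move=> fx; apply: wedge_eq; rewrite /= fx. Qed.

End Pair.

Lemma inl_sumE U V : @inl_sum (projn A) Z S U V = ninl U V.
Proof. by apply: nhom_eq => u; exact: wedge_eq. Qed.

Lemma inr_sumE U V : @inr_sum (projn A) Z S U V = ninr U V.
Proof. by apply: nhom_eq => v; exact: wedge_eq. Qed.

Lemma prl_sumE U V : @prl_sum (projn A) Z S U V = nfst U V.
Proof. exact: nhom_eq. Qed.

Lemma prr_sumE U V : @prr_sum (projn A) Z S U V = nsnd U V.
Proof. exact: nhom_eq. Qed.

Lemma wedge_map_inl M M' N N' (f : nhom M M') (g : nhom N N') m :
  wedge_map f g (inl M N m) = inl M' N' (f m).
Proof. by apply: wedge_eq; rewrite /= mfun_base. Qed.

Lemma wedge_map_inr M M' N N' (f : nhom M M') (g : nhom N N') n :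
  wedge_map f g (inr M N n) = inr M' N' (g n).
Proof. by apply: wedge_eq; rewrite /= mfun_base. Qed.

Lemma wedge_ext M N (L : module A) (f g : mhom (wedge M N) L) :
  (forall m, f (inl M N m) = g (inl M N m)) ->
  (forall n, f (inr M N n) = g (inr M N n)) -> f =1 g.
Proof. by move=> fgl fgr p; case: (wedgeP p) => -[x ->]. Qed.

Lemma wedge_symmetric_monoidal : symmetric_monoidal S.
Proof.
split=> *; apply: nhom_eq => p //.
(* Wedges sit inside products, so the coherence diagrams are checked coordinate by coordinate. *)
all: repeat (apply: wedge_eq => //=; try congr pair).
by case: (sval p).
Qed.

(** A test cone for the first component is completed by the zero object in the second, where
    existence and uniqueness are automatic. *)
Lemma cartesian_fst (C D : category) (ZD : zero_object D) (U X W V : prodc C D)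
    (i : hom U X) (p : hom U W) (q : hom X V) (j : hom W V) :
  cartesian i p q j -> cartesian i.1 p.1 q.1 j.1.
Proof.
move=> cart T x w qx_jw.
have [|u [[iu pu] uU]] := cart (T, zob ZD) (x, from0 ZD X.2) (w, from0 ZD W.2).
  by congr pair => //; rewrite (from0_uniq (_ \oc _)%cat) [RHS]from0_uniq.
exists u.1; split; first by move: iu pu => [<- _] [<- _].
move=> v [iv pv]; rewrite (uU (v, from0 ZD U.2)) //.
by split; congr pair => //; exact: from0_uniq.
Qed.

Lemma cartesian_snd (C D : category) (ZC : zero_object C) (U X W V : prodc C D)
    (i : hom U X) (p : hom U W) (q : hom X V) (j : hom W V) :
  cartesian i p q j -> cartesian i.2 p.2 q.2 j.2.
Proof.
move=> cart T x w qx_jw.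
have [|u [[iu pu] uU]] := cart (zob ZC, T) (from0 ZC X.1, x) (from0 ZC W.1, w).
  by congr pair => //; rewrite (from0_uniq (_ \oc _)%cat) [RHS]from0_uniq.
exists u.2; split; first by move: iu pu => [_ <-] [_ <-].
move=> v [iv pv]; rewrite (uU (from0 ZC U.1, v)) //.
by split; congr pair => //; exact: from0_uniq.
Qed.

Lemma wedge_map_cancel M M' N N' (f : nhom M M') (g : nhom N N')
    (f' : nhom M' M) (g' : nhom N' N) :
  cancel f f' -> cancel g g' -> cancel (wedge_map f g) (wedge_map f' g').
Proof.
by move=> fK gK x; apply: wedge_eq; rewrite /= fK gK; case: (sval x).
Qed.

Lemma inflation_wedge_map M M' N N' (f : nhom M M') (g : nhom N N') :
  inflation E f -> inflation E g ->
  @inflation _ E (pwedge M N) (pwedge M' N') (wedge_map f g).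
Proof.
move=> /inflationP[f' fK] /inflationP[g' gK].
by apply/inflationP; exists (wedge_map f' g'); exact: wedge_map_cancel.
Qed.

Lemma deflation_wedge_map M M' N N' (f : nhom M M') (g : nhom N N') :
  deflation E f -> deflation E g ->
  @deflation _ E (pwedge M N) (pwedge M' N') (wedge_map f g).
Proof.
move=> /deflationP[f' fK] /deflationP[g' gK].
by apply/deflationP; exists (wedge_map f' g'); exact: wedge_map_cancel.
Qed.

Lemma wedge_tensor_proto_exact :
  proto_exact_functor (prod_classes E E) E (tens S).
Proof.
move=> U X W V i p q j [[[i1 i2] [j1 j2] [p1 p2] [q1 q2] sq] cart _].
have sq1 : (q.1 \oc i.1 = j.1 \oc p.1)%cat by exact: (congr1 fst sq).
have sq2 : (q.2 \oc i.2 = j.2 \oc p.2)%cat by exact: (congr1 snd sq).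
have /cartesian_kernel_in_image-/(_ (And5 i1 j1 p1 q1 sq1)) K1 :=
  cartesian_fst Z cart.
have /cartesian_kernel_in_image-/(_ (And5 i2 j2 p2 q2 sq2)) K2 :=
  cartesian_snd Z cart.
apply/admissible_kernel_in_image.
  split; [exact: inflation_wedge_map|exact: inflation_wedge_map
    |exact: deflation_wedge_map|exact: deflation_wedge_map|].
  apply: nhom_eq => x; apply: wedge_eq; congr pair.
    exact: (nhomE sq1 (sval x).1).
  exact: (nhomE sq2 (sval x).2).
(* A point of a wedge lies in one factor, and the kernel criterion of that component applies
   there. *)
move=> x qx; have [[y xy]|[y xy]] := wedgeP x.
  have [u uy] : exists u, (i.1 : nhom U.1 X.1) u = y.
    by apply: K1; move/(congr1 sval): qx; rewrite xy => -[].
  exists (inl U.1 U.2 u); apply: wedge_eq; rewrite xy /= uy.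
  by congr pair; exact: mfun_base.
have [u uy] : exists u, (i.2 : nhom U.2 X.2) u = y.
  by apply: K2; move/(congr1 sval): qx; rewrite xy => -[].
exists (inr U.1 U.2 u); apply: wedge_eq; rewrite xy /= uy.
by congr pair; exact: mfun_base.
Qed.

(** * Splitting of conflations *)

Section Conflation.
Variables (U X V : projn A) (i : nhom U X) (p : nhom X V).
Hypothesis ip : @conflation (projn A) Z E U X V i p.

(** The kernel property is tested against the explicit kernel of [p], whose inclusion therefore
    factors through [i]. *)
Lemma conflation_exact x : p x = base V <-> exists u, i u = x.
Proof.
have [_ /deflationP[s sp] [pi0 kerp]] := ip.
split=> [px|[u <-]]; last exact: (nhomE pi0 u).
have {px}[y ->] := split_kernelP sp px.
have [|t [it _]] := kerp (kernel_proj sp) (split_kernel_incl sp).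
  by apply: nhom_eq => k; exact: split_kernel_incl0.
by exists (t y); exact: (nhomE it y).
Qed.

Variables (r : nhom X U) (s : nhom V X).
Hypotheses (ir : cancel i r) (sp : cancel s p).

(** If [r (s v)] were nontrivial, [s v] would lie in the image of [i], so [p] would kill it and [v]
    would be the base point. Hence any retraction and any section are complementary. *)
Lemma conflation_retr_section v : r (s v) = base U.
Proof.
apply: contrapT => rsv; have isv := cancel_normal ir rsv.
have : p (s v) = base V by apply/conflation_exact; exists (r (s v)).
by rewrite sp => v0; apply: rsv; rewrite v0 !mfun_base.
Qed.

Lemma conflation_pair x : r x = base U \/ p x = base V.
Proof.
have [px|px] := pselect (p x = base V); first by right.
by left; rewrite -(cancel_normal sp px) conflation_retr_section.
Qed.

Lemma conflation_pairK : cancel (wpair conflation_pair) (copair i s).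
Proof.
move=> x; have [px|px] := pselect (p x = base V).
  rewrite wpair_inl // copair_inl.
  by have /conflation_exact[u <-] := px; rewrite ir.
have [rx|//] := conflation_pair x.
by rewrite wpair_inr // copair_inr (cancel_normal sp).
Qed.

Lemma conflation_copairK : cancel (copair i s) (wpair conflation_pair).
Proof.
apply: (wedge_ext (f := mcomp (wpair conflation_pair) (copair i s))
  (g := mid _)) => [u|v].
  have piu : p (i u) = base V by apply/conflation_exact; exists u.
  by rewrite [LHS]/= copair_fun_inl; apply: wedge_eq; rewrite /= ir piu.
rewrite [LHS]/= copair_fun_inr; apply: wedge_eq.
by rewrite /= sp conflation_retr_section.
Qed.

End Conflation.

Lemma wedge_sum_epi U V W (f g : nhom (wedge U V) W) :
  ncomp f (ninl U V) = ncomp g (ninl U V) ->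
  ncomp f (ninr U V) = ncomp g (ninr U V) -> f = g.
Proof.
by move=> /nhomE fgl /nhomE fgr; apply: nhom_eq; apply: wedge_ext.
Qed.

Lemma wedge_sum_mono U V W (f g : nhom W (wedge U V)) :
  ncomp (nfst U V) f = ncomp (nfst U V) g ->
  ncomp (nsnd U V) f = ncomp (nsnd U V) g -> f = g.
Proof.
move=> /nhomE fgl /nhomE fgr; apply: nhom_eq => x; apply: wedge_eq.
rewrite [LHS]surjective_pairing [RHS]surjective_pairing.
by congr pair; [exact: fgl|exact: fgr].
Qed.

Section ConflationIso.
Variables (U X V : projn A) (i : nhom U X) (p : nhom X V).
Hypothesis ip : @conflation (projn A) Z E U X V i p.
Variables (r : nhom X U) (s : nhom V X).
Hypotheses (ir : cancel i r) (sp : cancel s p).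

Definition conflation_sum : nhom (wedge U V) X :=
  NHom (inj_normal (can_inj (conflation_copairK ip ir sp))).

Definition conflation_split : nhom X (wedge U V) :=
  NHom (inj_normal (can_inj (conflation_pairK ip ir sp))).

Lemma conflation_sum_iso : @is_iso (projn A) (pwedge U V) X conflation_sum.
Proof.
apply/is_iso_nhom; exists conflation_split.
by split; [exact: conflation_copairK|exact: conflation_pairK].
Qed.

Lemma conflation_split_iso : @is_iso (projn A) X (pwedge U V) conflation_split.
Proof.
apply/is_iso_nhom; exists conflation_sum.
by split; [exact: conflation_pairK|exact: conflation_copairK].
Qed.

Lemma conflation_sum_inl : ncomp conflation_sum (ninl U V) = i.
Proof. apply: nhom_eq => u; exact: (copair_inl i s). Qed.

Lemma conflation_sum_inr : ncomp conflation_sum (ninr U V) = s.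
Proof. apply: nhom_eq => u; exact: (copair_inr i s). Qed.

End ConflationIso.

Lemma wedge_exact_direct_sum : @exact_direct_sum (projn A) Z S E.
Proof.
split.
- exact: wedge_symmetric_monoidal.
- exact: wedge_tensor_proto_exact.
- by move=> U V W f g; rewrite inl_sumE inr_sumE; exact: wedge_sum_epi.
- by move=> U V W f g; rewrite prl_sumE prr_sumE; exact: wedge_sum_mono.
- move=> U X V i p s ip /nhomE sp; rewrite inl_sumE inr_sumE.
  have [/inflationP[r ir] _ _] := ip.
  exists (conflation_sum ip ir sp); split; first split.
  + exact: conflation_sum_iso.
  + exact: conflation_sum_inl.
  + exact: conflation_sum_inr.
  move=> phi [_ phil phir]; apply: wedge_sum_epi.
    by rewrite conflation_sum_inl; exact: (esym phil).
  by rewrite conflation_sum_inr; exact: (esym phir).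
- move=> U X V i p r ip /nhomE ir; rewrite prl_sumE prr_sumE.
  have [_ /deflationP[s sp] _] := ip.
  exists (conflation_split ip ir sp); split; first split.
  + exact: conflation_split_iso.
  + exact: nhom_eq.
  + exact: nhom_eq.
  move=> phi [_ phil phir]; apply: wedge_sum_mono.
    by apply: etrans (esym phil); exact: nhom_eq.
  by apply: etrans (esym phir); exact: nhom_eq.
Qed.

Lemma wedge_uniquely_split : uniquely_split S E.
Proof.
move=> U X V i p ip; rewrite inl_sumE prr_sumE.
have [/inflationP[r ir] /deflationP[s sp] _] := ip.
exists (conflation_sum ip ir sp); split; first split.
- exact: conflation_sum_iso.
- exact: conflation_sum_inl.
- apply: nhom_eq; apply: wedge_ext => [u|v].
    rewrite [LHS]/= copair_fun_inl.
    by apply/(conflation_exact ip); exists u.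
  by rewrite [LHS]/= copair_fun_inr sp.
move=> phi [_ phil /nhomE phir]; apply: wedge_sum_epi.
  by rewrite conflation_sum_inl; exact: (esym phil).
rewrite conflation_sum_inr; apply: nhom_eq => v.
(* Both points lie over [v], where normality of [p] leaves room for one only; this makes the
   splitting unique. *)
have pphi : p (s v) = p (phi (inr U V v)).
  by rewrite sp; exact: esym (phir (inr U V v)).
have [v0|v0] := pselect (v = base V); first by rewrite v0 !mfun_base.
by apply: (normalE pphi); rewrite sp.
Qed.

(* A subobject of a wedge is the wedge of its traces on the two factors. *)
Section Decomposition.
Variables (U X1 X2 : projn A) (i : nhom U (wedge X1 X2)).
Hypothesis iI : injective i.

Let inj_base u : i u = base _ -> u = base U.
Proof. by rewrite -(mfun_base i) => /iI. Qed.

(** If [i u] is off the first factor, it lies in the second; a multiple lying in both is the base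
    point, and injectivity carries this back to [u]. *)
Lemma left_summand : summand (fun u => (sval (i u)).2 = base X2).
Proof.
split=> [|a u iu|a u iuN iau]; first by rewrite mfun_base.
  by rewrite mfun_act /= iu act_base.
apply: inj_base; apply: wedge_eq; rewrite [LHS]surjective_pairing iau.
congr pair; rewrite mfun_act /=.
by case: (svalP (i u)) => [->|//]; rewrite act_base.
Qed.

Lemma right_summand : summand (fun u => (sval (i u)).1 = base X1).
Proof.
split=> [|a u iu|a u iuN iau]; first by rewrite mfun_base.
  by rewrite mfun_act /= iu act_base.
apply: inj_base; apply: wedge_eq; rewrite [LHS]surjective_pairing iau.
congr pair; rewrite mfun_act /=.
by case: (svalP (i u)) => [//|->]; rewrite act_base.
Qed.

Definition left_part : projn A := summand_proj left_summand.
Definition right_part : projn A := summand_proj right_summand.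

Let incl1 : nhom left_part U := summand_incl left_summand.
Let incl2 : nhom right_part U := summand_incl right_summand.
Let retr1 : nhom U left_part := summand_retr left_summand.
Let retr2 : nhom U right_part := summand_retr right_summand.

Let retr10 u : (sval (i u)).1 = base X1 -> retr1 u = base left_part.
Proof.
move=> iu; have [iu2|iu2] := pselect ((sval (i u)).2 = base X2).
  have -> : u = base U.
    by apply: inj_base; apply: wedge_eq; rewrite [LHS]surjective_pairing iu iu2.
  exact: mfun_base.
exact: (summand_retr_off left_summand iu2).
Qed.

Let retr20 u : (sval (i u)).2 = base X2 -> retr2 u = base right_part.
Proof.
move=> iu; have [iu1|iu1] := pselect ((sval (i u)).1 = base X1).
  have -> : u = base U.
    by apply: inj_base; apply: wedge_eq; rewrite [LHS]surjective_pairing iu1 iu.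
  exact: mfun_base.
exact: (summand_retr_off right_summand iu1).
Qed.

Lemma parts_disjoint u : retr1 u = base left_part \/ retr2 u = base right_part.
Proof. by case: (svalP (i u)) => [/retr10|/retr20]; [left|right]. Qed.

Lemma decomposeK : cancel (wpair parts_disjoint) (copair incl1 incl2).
Proof.
move=> u; case: (svalP (i u)) => iu.
  rewrite wpair_inr ?retr10 // copair_inr; exact: (summand_retrK right_summand).
rewrite wpair_inl ?retr20 // copair_inl; exact: (summand_retrK left_summand).
Qed.

Lemma recomposeK : cancel (copair incl1 incl2) (wpair parts_disjoint).
Proof.
apply: (wedge_ext (f := mcomp (wpair parts_disjoint) (copair incl1 incl2))
  (g := mid _)) => u.
  rewrite -[LHS]/(wpair parts_disjoint (copair incl1 incl2 (inl _ _ u))).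
  rewrite copair_inl wpair_inl; last by apply: retr20; exact: (svalP u).
  by congr (inl _ _ _); exact: summand_inclK.
rewrite -[LHS]/(wpair parts_disjoint (copair incl1 incl2 (inr _ _ u))).
rewrite copair_inr wpair_inr; last by apply: retr10; exact: (svalP u).
by congr (inr _ _ _); exact: summand_inclK.
Qed.

Definition decompose : @iso (projn A) U (pwedge left_part right_part) :=
  @niso A U (pwedge left_part right_part) _ _ decomposeK recomposeK.

Definition recompose : @iso (projn A) (pwedge left_part right_part) U :=
  @niso A (pwedge left_part right_part) U _ _ recomposeK decomposeK.

Lemma left_part_inl (u : left_part) :
  inl X1 X2 (sval (i (sval u))).1 = i (sval u).
Proof. by apply: wedge_eq; rewrite [RHS]surjective_pairing (svalP u). Qed.

Lemma right_part_inr (u : right_part) :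
  inr X1 X2 (sval (i (sval u))).2 = i (sval u).
Proof. by apply: wedge_eq; rewrite [RHS]surjective_pairing (svalP u). Qed.

End Decomposition.

Lemma wedge_combinatorial_inflation U X1 X2
    (i : @hom (projn A) U (pwedge X1 X2)) : inflation E i ->
  exists (U1 U2 : projn A) (phi : @iso (projn A) U (pwedge U1 U2))
      (i1 : @hom (projn A) U1 X1) (i2 : @hom (projn A) U2 X2),
    [/\ inflation E i1, inflation E i2 & i = ((i1 \ot[S] i2) \oc phi)%cat].
Proof.
move=> /inflationP[r ir]; have iI := can_inj ir.
pose SL := left_summand iI; pose SR := right_summand iI.
pose i1 : nhom (left_part iI) X1 := ncomp (nfst X1 X2) (ncomp i (summand_incl SL)).
pose i2 : nhom (right_part iI) X2 :=
  ncomp (nsnd X1 X2) (ncomp i (summand_incl SR)).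
exists (left_part iI), (right_part iI), (decompose iI), i1, i2; split.
- apply/inflationP; exists (ncomp (summand_retr SL) (ncomp r (ninl X1 X2))) => u.
  rewrite -[LHS]/(summand_retr SL (r (inl X1 X2 (sval (i (sval u))).1))).
  by rewrite left_part_inl ir; exact: (summand_inclK SL).
- apply/inflationP; exists (ncomp (summand_retr SR) (ncomp r (ninr X1 X2))) => u.
  rewrite -[LHS]/(summand_retr SR (r (inr X1 X2 (sval (i (sval u))).2))).
  by rewrite right_part_inr ir; exact: (summand_inclK SR).
- apply: nhom_eq => u; rewrite -[in LHS](decomposeK iI u).
  (* On each part the other component of [i] vanishes, so there [i] is the wedge of [i1] and
     [i2]. *)
  set w := wpair _ u; rewrite -[RHS]/(wedge_map i1 i2 w).
  have [[v ->]|[v ->]] := wedgeP w.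
    by rewrite copair_inl; apply: wedge_eq; rewrite [LHS]surjective_pairing
      [X in (_, X)](svalP v) /= mfun_base.
  by rewrite copair_inr; apply: wedge_eq; rewrite [LHS]surjective_pairing
    [X in (X, _)](svalP v) /= mfun_base.
Qed.

(** [V] is decomposed along a section [s] of [p]. A nontrivial [p (inl x)] is sent back to [inl x]
    by [s], hence lies in the left part; likewise on the right. *)
Lemma wedge_combinatorial_deflation X1 X2 V
    (p : @hom (projn A) (pwedge X1 X2) V) : deflation E p ->
  exists (V1 V2 : projn A) (phi : @iso (projn A) (pwedge V1 V2) V)
      (p1 : @hom (projn A) X1 V1) (p2 : @hom (projn A) X2 V2),
    [/\ deflation E p1, deflation E p2 & p = (phi \oc (p1 \ot[S] p2))%cat].
Proof.
move=> /deflationP[s sp]; have sI := can_inj sp.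
pose SL := left_summand sI; pose SR := right_summand sI.
pose p1 : nhom X1 (left_part sI) := ncomp (summand_retr SL) (ncomp p (ninl X1 X2)).
pose p2 : nhom X2 (right_part sI) :=
  ncomp (summand_retr SR) (ncomp p (ninr X1 X2)).
exists (left_part sI), (right_part sI), (recompose sI), p1, p2; split.
- apply/deflationP; exists (ncomp (nfst X1 X2) (ncomp s (summand_incl SL))) => v.
  rewrite -[LHS]/(summand_retr SL (p (inl X1 X2 (sval (s (sval v))).1))).
  by rewrite left_part_inl sp; exact: (summand_inclK SL).
- apply/deflationP; exists (ncomp (nsnd X1 X2) (ncomp s (summand_incl SR))) => v.
  rewrite -[LHS]/(summand_retr SR (p (inr X1 X2 (sval (s (sval v))).2))).
  by rewrite right_part_inr sp; exact: (summand_inclK SR).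
- apply: nhom_eq; apply: wedge_ext => x.
    rewrite -[RHS]/(@copair (left_part sI) (right_part sI) _
      (summand_incl SL) (summand_incl SR)
      (wedge_map p1 p2 (inl _ _ x))).
    rewrite (@wedge_map_inl _ (left_part sI) _ (right_part sI)) copair_inl.
    apply: esym (summand_retrK SL _).
    rewrite -[X in s X]/(p (inl X1 X2 x)).
    have [->|px] := pselect (p (inl X1 X2 x) = base V); first by rewrite mfun_base.
    by rewrite (cancel_normal sp px).
  rewrite -[RHS]/(@copair (left_part sI) (right_part sI) _
      (summand_incl SL) (summand_incl SR)
    (wedge_map p1 p2 (inr _ _ x))).
  rewrite (@wedge_map_inr _ (left_part sI) _ (right_part sI)) copair_inr.
  apply: esym (summand_retrK SR _).
  rewrite -[X in s X]/(p (inr X1 X2 x)).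
  have [->|px] := pselect (p (inr X1 X2 x) = base V); first by rewrite mfun_base.
  by rewrite (cancel_normal sp px).
Qed.

Lemma wedge_combinatorial : combinatorial S E.
Proof.
split=> *; [exact: wedge_combinatorial_inflation|].
exact: wedge_combinatorial_deflation.
Qed.

End DirectSum.

(** * Bases of projective modules *)

Section Bases.
Variable A : pointedMonoidType.
Implicit Types M N L : module A.
Local Notation R := (regular A).

Section Extend.
Variables (M N : module A) (T : Type) (d : T -> mhom M R) (t : T -> N).
Hypothesis d_disjoint : forall k l m, d k m <> 0 -> d l m <> 0 -> k = l.

(** At most one coordinate of [m] is nonzero; it becomes the coefficient of the prescribed value
    [t k]. Points without nonzero coordinate go to the base point. *)
Let ext_fun (m : M) : N :=
  if pselect (exists k, d k m <> 0) is left e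
  then act (d (sval (cid e)) m : A) (t (sval (cid e))) else base N.

Let ext_funE k m : (forall l, l <> k -> d l m = 0) ->
  ext_fun m = act (d k m : A) (t k).
Proof.
move=> dm; rewrite /ext_fun; case: pselect => [e|dN].
  case: cid => l /= dlm; have [->//|lk] := pselect (l = k).
  by case: dlm; exact: dm.
have -> : d k m = 0 by apply: contrapT => dkm; apply: dN; exists k.
by rewrite act0.
Qed.

Let ext_fun0 m : (forall l, d l m = 0) -> ext_fun m = base N.
Proof. by move=> dm; rewrite /ext_fun; case: pselect => // -[k]; case. Qed.

Let ext_base : ext_fun (base M) = base N.
Proof. by apply: ext_fun0 => l; exact: mfun_base. Qed.

Let ext_act a m : ext_fun (act a m) = act a (ext_fun m).
Proof.
have [[k dkm]|dN] := pselect (exists k, d k m <> 0).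
  have dlm l : l <> k -> d l m = 0.
    by move=> lk; apply: contrapT => dlm; apply: lk; exact: d_disjoint dlm dkm.
  rewrite (ext_funE dlm) (@ext_funE k) => [|l /dlm dl].
    by rewrite mfun_act actM.
  by rewrite mfun_act dl; exact: mul_pzero.
have dm l : d l m = 0 by apply: contrapT => dlm; apply: dN; exists l.
rewrite !ext_fun0 ?act_base // => l.
by rewrite mfun_act dm; exact: mul_pzero.
Qed.

Definition extend : mhom M N := MHom ext_base ext_act.

Lemma extendE k m : (forall l, l <> k -> d l m = 0) ->
  extend m = act (d k m : A) (t k).
Proof. exact: ext_funE. Qed.

Lemma extend0 m : (forall l, d l m = 0) -> extend m = base N.
Proof. exact: ext_fun0. Qed.

End Extend.

Section Free.
Variable n : nat.

(* The n-fold wedge of A, realised inside A^n. *)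
Let car := {f : 'I_n -> A | forall i j, f i <> 0 -> f j <> 0 -> i = j}.

Let car_eq (x y : car) : (forall i, sval x i = sval y i) -> x = y.
Proof.
case: x y => [x hx] [y hy] /= /funext xy; case: _ / xy hy => hy.
by congr exist; exact: Prop_irrelevance.
Qed.

Let zero_subproof (i j : 'I_n) : 0 <> 0 :> A -> 0 <> 0 :> A -> i = j.
Proof. by []. Qed.
Let zero : car := exist _ (fun=> 0) zero_subproof.

Let act_subproof a (f : car) i j :
  a * sval f i <> 0 -> a * sval f j <> 0 -> i = j.
Proof.
move=> fi fj; apply: (svalP f) => f0; [apply: fi|apply: fj];
  by rewrite f0 mul_pzero.
Qed.
Let fact a (f : car) : car := exist _ (fun i => a * sval f i) (@act_subproof a f).

Let fact_base a : fact a zero = zero.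
Proof. by apply: car_eq => i; exact: mul_pzero. Qed.
Let fact0 f : fact 0 f = zero.
Proof. by apply: car_eq => i; exact: pzero_mul. Qed.
Let fact1 f : fact 1 f = f.
Proof. by apply: car_eq => i; exact: mul1g. Qed.
Let factM a b f : fact (a * b) f = fact a (fact b f).
Proof. by apply: car_eq => i; exact: esym (mulgA _ _ _). Qed.

Definition free : module A :=
  @Module A car zero fact fact_base fact0 fact1 factM.

Definition free_coord i : mhom free R :=
  @MHom A free R (fun f => sval f i) erefl (fun _ _ => erefl).

Lemma free_coord_disjoint i j (f : free) :
  free_coord i f <> 0 -> free_coord j f <> 0 -> i = j.
Proof. exact: (svalP f). Qed.

Let delta_subproof (i : 'I_n) (a : A) (j k : 'I_n) :
  (if j == i then a else 0) <> 0 -> (if k == i then a else 0) <> 0 -> j = k.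
Proof. by case: (j =P i) => // -> _; case: (k =P i). Qed.

Definition free_delta i (a : A) : free := exist _ _ (@delta_subproof i a).

Lemma free_deltaE i a : free_coord i (free_delta i a) = a.
Proof. by rewrite /= eqxx. Qed.

Lemma free_delta_neq i a j : j <> i -> free_coord j (free_delta i a) = 0.
Proof. by move=> ji /=; case: (j =P i). Qed.

End Free.

(** The dual system [d] makes coefficients unique, so [M] is identified with the wedge of copies of
    [A] indexed by [T]. *)
Definition basis M (T : finType) (b : T -> M) (d : T -> mhom M R) : Prop :=
  [/\ forall m, m = base M \/ exists k, m = act (d k m : A) (b k),
      forall k, d k (b k) = 1 &
      forall k l, k <> l -> d k (b l) = 0].

Section Basis.
Variables (M : module A) (T : finType) (b : T -> M) (d : T -> mhom M R).
Hypothesis B : basis b d.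

Lemma basis_coord k m : d k m <> 0 -> m = act (d k m : A) (b k).
Proof.
have [span d1 d0] := B; have [->|[l ml]] := span m; first by rewrite mfun_base.
have [->//|kl] := pselect (k = l).
by case; rewrite ml mfun_act d0 //; exact: mul_pzero.
Qed.

Lemma basis_coord_normal k : normal (d k).
Proof.
move=> n n0 x y xn yn; rewrite (@basis_coord k x) ?xn //.
by rewrite (@basis_coord k y) yn.
Qed.

Lemma basis_coord_disjoint k l m : d k m <> 0 -> d l m <> 0 -> k = l.
Proof.
have [_ _ d0] := B; move=> /basis_coord-> dlm; apply: contrapT => kl; apply: dlm.
by rewrite mfun_act d0 ?mul_pzero => [|lk]; [exact: mul_pzero|exact: kl].
Qed.

Lemma basis_eq N (f g : mhom M N) : (forall k, f (b k) = g (b k)) -> f =1 g.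
Proof.
have [span _ _] := B; move=> fg m.
have [->|[k ->]] := span m; first by rewrite !mfun_base.
by rewrite !mfun_act fg.
Qed.

Lemma basis_fg_projective : fg_projective M.
Proof.
have [span d1 d0] := B; split.
  exists #|T|, (b \o enum_val) => m; have [|[k mk]] := span m; first by left.
  by right; exists (enum_rank k), (d k m); rewrite /= enum_rankK.
move=> N L q f qS; have [t tP] := choice (fun k => qS (f (b k))).
pose h := extend t basis_coord_disjoint.
exists h; apply: mhom_eq; apply: basis_eq => k /=.
rewrite -[LHS]/(q (h (b k))) (extendE t basis_coord_disjoint (k := k)) => [|l /d0//].
by rewrite d1 act1.
Qed.

End Basis.

Lemma one_eq_zero (a : A) : 1 = 0 :> A -> a = 0.
Proof. by rewrite -[a]mul1g => ->; exact: pzero_mul. Qed.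

(* Partial cancellation leaves no idempotents besides 0 and 1, so that each
   summand of a free module is spanned by a part of its basis. *)
Lemma projective_basis (cancA : right_partially_cancellative A) M :
  fg_projective M -> exists (T : finType) (b : T -> M) (d : T -> mhom M R),
    basis b d.
Proof.
move=> [[n [g gP]] projM].
pose q := extend g (@free_coord_disjoint n).
have qS : surjective q.
  move=> m; have [->|[i [a ->]]] := gP m.
    by exists (base _); rewrite mfun_base.
  exists (free_delta i a).
  rewrite (extendE g (@free_coord_disjoint n) (k := i)) ?free_deltaE //.
  exact: free_delta_neq.
have [h qh] := projM _ _ q (mid M) qS.
have {}qh m : q (h m) = m by rewrite -[LHS]/(mcomp q h m) qh.
pose d k := mcomp (free_coord k) h.
have d_disjoint k l m : d k m <> 0 -> d l m <> 0 -> k = l.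
  exact: free_coord_disjoint.
have span m : m = base M \/
    exists k, [/\ d k m <> 0, d k (g k) = 1 & m = act (d k m : A) (g k)].
  have dg k x : d k x <> 0 -> x = act (d k x : A) (g k).
    move=> dkx; rewrite -[LHS]qh; apply: extendE => l lk.
    by apply: contrapT => dlx; apply: lk; exact: d_disjoint dlx dkx.
  have [[k dkm]|dN] := pselect (exists k, d k m <> 0); last first.
    left; rewrite -(qh m); apply: extend0 => l.
    by apply: contrapT => dlm; apply: dN; exists l.
  right; exists k; split=> //; last exact: dg.
  have dgk : d k (g k) <> 0.
    move=> dgk; apply: (dkm); rewrite (dg _ _ dkm) mfun_act dgk.
    exact: mul_pzero.
  (* Applying [d k] to the expansion of [g k] itself shows that [d k (g k)] is idempotent; being
     nonzero, it is 1 by cancellation against [1]. *)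
  have idem : 1 * (d k (g k) : A) = (d k (g k) : A) * (d k (g k) : A).
    by rewrite mul1g; have := congr1 (d k) (dg _ _ dgk); rewrite mfun_act.
  by have [/esym//|[]] := cancA _ _ _ idem; rewrite mul1g.
pose T := {k : 'I_n | `[< d k (g k) = 1 >]}.
exists T, (fun k : T => g (val k)), (fun k : T => d (val k)); split.
- move=> m; have [->|[k [_ dk1 mk]]] := span m; first by left.
  by right; exists (exist _ k (asboolT dk1)).
- by move=> k; exact: (asboolW (valP k)).
- move=> k l kl; apply: contrapT => dkl; apply: kl; apply: val_inj.
  (* The coordinate of index [l] at [g l] is 1, so disjointness forces [k = l] unless [1 = 0], in
     which case all coordinates vanish. *)
  apply: (d_disjoint _ _ _ dkl); rewrite (asboolW (valP l)) => one0.
  by apply: dkl; exact: one_eq_zero.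
Qed.

End Bases.

(** * Duality *)

Section Duality.
Variables (A : pointedMonoidType).
Hypotheses (revA : right_reversible A) (cancA : right_partially_cancellative A).
Variables (sigma : A -> A) (sigmaP : pm_involution sigma).
Implicit Types M N L U V W X Y : projn A.
Local Notation R := (regular A).
Local Notation E := (projn_classes A).
Local Notation Z := (projn_zero A).
Local Notation S := (wedge_tensor A).
Local Notation inl M N := (wedge_inl M N).
Local Notation inr M N := (wedge_inr M N).
Local Notation D := (dual cancA sigmaP).

(** The involution turns right cancellation into left cancellation. *)
Lemma left_partial_cancel (a b c : A) : c * a = c * b -> c * a <> 0 -> a = b.
Proof.
move=> cab ca0; have sK := involK sigmaP.
have : sigma a * sigma c = sigma b * sigma c by rewrite -!(involM sigmaP) cab.
case/cancA => [/(can_inj sK)//|[]].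
rewrite -(involM sigmaP) => /(congr1 sigma).
by rewrite sK (invol0 sigmaP) => /ca0.
Qed.

(** Reversibility gives a nonzero common multiple of [f x] and [f y], and normality of [f] lifts it
    to one of [x] and [y]. *)
Lemma nhom_common_multiple (M : module A) (f : nhom M R) x y :
  f x <> base R -> f y <> base R ->
  exists a c, act a x = act c y /\ f (act a x) <> base R.
Proof.
move=> fx fy; have [a [c [afx_cfy afx]]] := revA fx fy.
have afx' : f (act a x) <> base R by rewrite mfun_act; exact: afx.
exists a, c; split=> //; apply: (@normalE _ _ _ f) => //.
by rewrite !mfun_act; exact: afx_cfy.
Qed.

(** Otherwise [b k] and [b l] would have a common multiple not killed by [f]; but its coordinate at
    [k], computed from [b l], is zero. *)
Lemma dual_support_unique (M : module A) (T : finType) (b : T -> M)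
    (d : T -> mhom M R) (f : nhom M R) k l :
  basis b d -> f (b k) <> base R -> f (b l) <> base R -> k = l.
Proof.
move=> [_ d1 d0] fk fl; have [a [c [akcl fak]]] := nhom_common_multiple fk fl.
apply: contrapT => kl; apply: fak.
have a0 : a = 0.
  have := congr1 (d k) akcl; rewrite !mfun_act d1 d0 //=.
  by rewrite mulg1 => ->; exact: mul_pzero.
by rewrite a0 act0 mfun_base.
Qed.

Lemma nhom_nonzero (M N : module A) (f g : nhom M N) :
  (forall m, g m = base N) -> f <> g -> exists m, f m <> base N.
Proof.
move=> g0 fg; apply: contrapT => fN; apply: fg; apply: nhom_eq => m.
by rewrite g0; apply: contrapT => fm; apply: fN; exists m.
Qed.

(** With [m] a multiple of [b k], left cancellation gives equality at [b k], and neither map is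
    nonzero at another basis vector. This is what makes evaluation maps on the dual normal. *)
Lemma dual_eq M (f g : nhom M R) m : f m = g m -> f m <> base R -> f = g.
Proof.
have [T [b [d B]]] := projective_basis cancA (projmodP M).
have [span d1 d0] := B; have [->|[k mk]] := span m; first by rewrite mfun_base.
rewrite {}mk !mfun_act /= => fgm fm.
have fgk : f (b k) = g (b k) by exact: left_partial_cancel fgm fm.
have fk : f (b k) <> base R by move=> fk; apply: fm; rewrite fk; exact: mul_pzero.
apply: nhom_eq; apply: (basis_eq B) => l.
have [->//|lk] := pselect (l = k).
have -> : f (b l) = base R.
  by apply: contrapT => fl; apply: lk; exact: dual_support_unique B fl fk.
apply: contrapT => gl; apply: lk; apply: (dual_support_unique (f := g) B).
  by move=> gl0; apply: gl.
by rewrite -fgk.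
Qed.

(** Coordinate maps are normal, hence among the [f], and they determine a point. *)
Lemma coord_separates M m m' :
  (forall f : nhom M R, f m = f m') -> m = m'.
Proof.
have [T [b [d B]]] := projective_basis cancA (projmodP M).
have [span d1 d0] := B; move=> fmm'.
have dmm' k : d k m = d k m' by exact: fmm' (NHom (basis_coord_normal B (k := k))).
have [m0|[k mk]] := span m; have [m'0|[l m'l]] := span m'.
- by rewrite m0.
- by rewrite m'l -dmm' m0 mfun_base act0.
- by rewrite mk dmm' m'0 mfun_base act0.
- have [dkm|dkm] := pselect (d k m = 0); last first.
    by rewrite mk dmm'; apply/esym/(basis_coord B); rewrite -dmm'.
  have m0 : m = base M by rewrite mk dkm act0.
  by rewrite m'l -dmm' m0 mfun_base act0.
Qed.

Definition dual_basis_vector (M : module A) (T : finType) (b : T -> M)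
    (d : T -> mhom M R) (B : basis b d) (k : T) : D M :=
  NHom (basis_coord_normal B (k := k)).

Lemma commute1 (a : A) : commute 1 a.
Proof. by rewrite /commute mul1g mulg1. Qed.

(** By [dual_eq] one basis vector with nonzero value suffices for the comparison; [sigma] enters
    because scalars act on the dual by right multiplication with their image under [sigma]. *)
Lemma dual_span M (T : finType) (b : T -> M) (d : T -> mhom M R)
    (B : basis b d) (f : D M) : f <> base (D M) ->
  exists k, f (b k) <> base R /\
    f = act (sigma (f (b k))) (dual_basis_vector B k).
Proof.
have [span d1 d0] := B; move=> f0.
have [m fm] := @nhom_nonzero _ _ f (base (D M)) (fun=> erefl) f0.
have [k fk] : exists k, f (b k) <> base R.
  have [m0|[k mk]] := span m; first by case: fm; rewrite m0 mfun_base.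
  by exists k => fk; apply: fm; rewrite mk mfun_act fk act_base.
exists k; split=> //; apply: (dual_eq (m := b k)) => //.
by rewrite /= /dual_act_fun /= d1 mul1g (involK sigmaP).
Qed.

Lemma dual_fg_projective M : fg_projective (D M).
Proof.
have [T [b [d B]]] := projective_basis cancA (projmodP M).
have [span d1 d0] := B.
(* The coordinates of the dual basis are the maps sending [f] to [sigma (f (b k))], that is
   [theta_at] with [eps] taken to be 1. *)
apply: (@basis_fg_projective _ _ T (dual_basis_vector B)
  (fun k => theta_at cancA sigmaP commute1 (b k))); split.
- move=> f; have [->|/(dual_span B)[k [_ fk]]] := pselect (f = base (D M)).
    by left.
  by right; exists k; rewrite /= /theta_fun mul1g.
- by move=> k; rewrite /= /theta_fun /= d1 mul1g (invol1 sigmaP).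
- by move=> k l kl; rewrite /= /theta_fun /= d0 ?mul1g ?(invol0 sigmaP) // => /esym.
Qed.

(** Where the common composite is nonzero at [m], both functionals agree at [f m] with a nonzero
    value, so [dual_eq] applies. *)
Lemma precomp_normal M N (f : nhom M N) : normal (precomp cancA sigmaP f).
Proof.
move=> n n0 g g' gn g'n; rewrite -{}gn in n0 g'n.
have [m gm] := @nhom_nonzero _ _ (precomp cancA sigmaP f g) (base (D M))
  (fun=> erefl) n0.
by apply: (dual_eq (m := f m)) => //; exact: esym (nhomE g'n m).
Qed.

Section Theta.
Variables (eps : A) (eps_central : forall a : A, commute eps a).
Hypothesis eps_sigma : eps * sigma eps = 1.

Let eps_inj a b : eps * sigma a = eps * sigma b -> a = b.
Proof.
move=> /(congr1 (fun x => sigma eps * x)); rewrite !mulgA -eps_central eps_sigma.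
by rewrite !mul1g => /(can_inj (involK sigmaP)).
Qed.

Lemma theta_at_normal M (m : M) : normal (theta_at cancA sigmaP eps_central m).
Proof.
move=> n n0 f g fn gn; rewrite -{}fn in n0 gn.
have fg : f m = g m by exact: eps_inj (esym gn).
apply: (dual_eq fg) => fm0; apply: n0.
by rewrite /= /theta_fun fm0 (invol0 sigmaP); exact: mul_pzero.
Qed.

Lemma theta_injective M
    (H : forall m : M, normal (theta_at cancA sigmaP eps_central m)) :
  injective (theta H).
Proof.
move=> m m' mm'; apply: coord_separates => f; exact: eps_inj (nhomE mm' f).
Qed.

Lemma duality_wd : duality_well_defined cancA sigmaP eps_central.
Proof.
apply: (@Build_duality_well_defined _ _ _ _ _ _ dual_fg_projective
  precomp_normal theta_at_normal) => M.
exact: inj_normal (@theta_injective M _).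
Qed.

End Theta.
End Duality.

(** * The axioms of a duality *)

Section DualityAxioms.
Variables (A : pointedMonoidType).
Hypotheses (revA : right_reversible A) (cancA : right_partially_cancellative A).
Variables (sigma : A -> A) (sigmaP : pm_involution sigma).
Variables (eps : A) (eps_central : forall a : A, commute eps a).
Hypothesis eps_sigma : eps * sigma eps = 1.
Implicit Types M N L U V W X Y : projn A.
Local Notation R := (regular A).
Local Notation E := (projn_classes A).
Local Notation Z := (projn_zero A).
Local Notation S := (wedge_tensor A).
Local Notation inl M N := (wedge_inl M N).
Local Notation inr M N := (wedge_inr M N).
Local Notation D := (dual cancA sigmaP).
Local Notation wd := (duality_wd revA cancA sigmaP eps_central eps_sigma).
Local Notation P := (dual_functor wd).
Local Notation PD := (dual_projmod wd).

Lemma dual_fmap_cancel M N (f : nhom M N) (g : nhom N M) :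
  cancel f g -> cancel (dual_fmap wd g) (dual_fmap wd f).
Proof. by move=> fK h; apply: nhom_eq => m; rewrite /= fK. Qed.

Lemma dual_fmap_inflation M N (f : nhom M N) :
  deflation E f -> @inflation _ E (PD N) (PD M) (dual_fmap wd f).
Proof.
move=> /deflationP[s sf]; apply/inflationP; exists (dual_fmap wd s).
exact: dual_fmap_cancel.
Qed.

Lemma dual_fmap_deflation M N (f : nhom M N) :
  inflation E f -> @deflation _ E (PD N) (PD M) (dual_fmap wd f).
Proof.
move=> /inflationP[r fr]; apply/deflationP; exists (dual_fmap wd r).
exact: dual_fmap_cancel.
Qed.

Lemma dual_functor_proto_exact : proto_exact_functor (op_classes E) E P.
Proof.
move=> U X W V i p q j [[di dj ip iq sq] cart _].
(* A cartesian square in the opposite category is a cocartesian one read backwards, so the kernel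
   criterion applies. *)
have sq' : @exact_square (projn A) E V X W U q j i p by split.
have /(cocartesian_kernel_in_image sq') K : @cocartesian (projn A) V X W U q j i p.
  exact: cart.
apply/admissible_kernel_in_image.
  split; [exact: dual_fmap_inflation|exact: dual_fmap_inflation
    |exact: dual_fmap_deflation|exact: dual_fmap_deflation|].
  by rewrite -!fmapM sq.
move=> g gq; have /deflationP[s si] := di.
(* As [g] vanishes on the image of [q], it vanishes on the kernel of [i], and so factors through [i]
   by way of the section [s]. *)
exists (ncomp g s); apply: nhom_eq => x /=.
have [ix|ix] := pselect ((i : nhom _ _) x = base (pmod U)); last first.
  by rewrite (cancel_normal si).
have [v vx] := K x ix; rewrite ix !mfun_base -vx.
exact: esym (nhomE gq v).
Qed.

(** If both restrictions were nonzero, reversibility would give a common multiple of points of the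
    two factors not killed by [h]; the factors meet only in the base point. *)
Lemma dual_sum_disjoint U V (h : D (pwedge U V)) :
  precomp cancA sigmaP (ninl U V) h = base (D U) \/
  precomp cancA sigmaP (ninr U V) h = base (D V).
Proof.
have [hl|hl] := pselect (precomp cancA sigmaP (ninl U V) h = base (D U)).
  by left.
right; apply: contrapT => hr.
have [u hu] := @nhom_nonzero _ _ _ (precomp cancA sigmaP (ninl U V) h)
  (base (D U)) (fun=> erefl) hl.
have [v hv] := @nhom_nonzero _ _ _ (precomp cancA sigmaP (ninr U V) h)
  (base (D V)) (fun=> erefl) hr.
have [a [c [auv]]] :=
  @nhom_common_multiple _ revA _ h (inl U V u) (inr U V v) hu hv.
have au : act a u = base U.
  by have := congr1 (fun w => (sval w).1) auv; rewrite /= act_base.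
by rewrite -mfun_act au !mfun_base.
Qed.

Definition dual_sum U V : mhom (wedge (PD U) (PD V)) (D (pwedge U V)) :=
  @copair A (PD U) (PD V) _
    (precomp cancA sigmaP (nfst U V)) (precomp cancA sigmaP (nsnd U V)).

Definition dual_split U V : mhom (D (pwedge U V)) (wedge (PD U) (PD V)) :=
  @wpair A _ (PD U) (PD V)
    (precomp cancA sigmaP (ninl U V)) (precomp cancA sigmaP (ninr U V))
    (@dual_sum_disjoint U V).

Lemma dual_sum_inl U V (f : D U) :
  dual_sum U V (inl (PD U) (PD V) f) = ncomp f (nfst U V).
Proof. exact: (@copair_inl A (PD U) (PD V)). Qed.

Lemma dual_sum_inr U V (g : D V) :
  dual_sum U V (inr (PD U) (PD V) g) = ncomp g (nsnd U V).
Proof. exact: (@copair_inr A (PD U) (PD V)). Qed.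

Lemma dual_sumK U V : cancel (dual_sum U V) (dual_split U V).
Proof.
move=> p; have [[f ->]|[g ->]] := wedgeP p.
  rewrite dual_sum_inl; apply: wedge_eq; congr pair; apply: nhom_eq => x //.
  exact: (mfun_base (nfun f)).
rewrite dual_sum_inr; apply: wedge_eq; congr pair; apply: nhom_eq => x //.
exact: (mfun_base (nfun g)).
Qed.

Lemma dual_splitK U V : cancel (dual_split U V) (dual_sum U V).
Proof.
move=> h; have [hl|hr] := dual_sum_disjoint h.
  rewrite [dual_split _ _ _](@wpair_inr A _ (PD U) (PD V) _ _
    (@dual_sum_disjoint U V) h hl) dual_sum_inr.
  apply: nhom_eq; apply: wedge_ext => x //.
  apply: etrans (esym (nhomE hl x)).
  exact: (mfun_base (nfun (ncomp h (ninr U V)))).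
rewrite [dual_split _ _ _](@wpair_inl A _ (PD U) (PD V) _ _
    (@dual_sum_disjoint U V) h hr) dual_sum_inl.
apply: nhom_eq; apply: wedge_ext => x //.
apply: etrans (esym (nhomE hr x)).
exact: (mfun_base (nfun (ncomp h (ninl U V)))).
Qed.

Definition dual_mu U V :
    @iso (projn A) (pwedge (PD U) (PD V)) (PD (pwedge U V)) :=
  @niso A (pwedge (PD U) (PD V)) (PD (pwedge U V)) _ _
    (@dual_sumK U V) (@dual_splitK U V).

Lemma dual_eta1 : cancel (mfrom0 (PD (zob Z))) (mto0 (PD (zob Z))).
Proof. by case. Qed.

Lemma dual_eta2 : cancel (mto0 (PD (zob Z))) (mfrom0 (PD (zob Z))).
Proof. by move=> f; apply: nhom_eq; case; rewrite /= mfun_base. Qed.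

Definition dual_eta : @iso (projn A) (zob Z) (PD (zob Z)) :=
  @niso A (zob Z) (PD (zob Z)) _ _ dual_eta1 dual_eta2.

Definition dual_monoidal_data : monoidal_data (op_tensor S) S P :=
  @MonoidalData (op (projn A)) (projn A) (zob Z) (zob Z) (op_tensor S) S P
    dual_mu dual_eta.

(** A functional on [V] is extended through the projection to [V], which kills the first factor.
    With its mirror image below, this reduces the coherence of [dual_mu] to evaluation on each
    factor. *)
Lemma dual_sum_left U V p x : (sval x).2 = base V ->
  (dual_sum U V p : D (pwedge U V)) x = ((sval p).1 : D U) (sval x).1.
Proof.
move=> x2; have [[f ->]|[g ->]] := wedgeP p; first by rewrite dual_sum_inl.
by rewrite dual_sum_inr /= x2; exact: (mfun_base (nfun g)).
Qed.

Lemma dual_sum_right U V p x : (sval x).1 = base U ->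
  (dual_sum U V p : D (pwedge U V)) x = ((sval p).2 : D V) (sval x).2.
Proof.
move=> x1; have [[f ->]|[g ->]] := wedgeP p; last by rewrite dual_sum_inr.
by rewrite dual_sum_inl /= x1; exact: (mfun_base (nfun f)).
Qed.

Lemma dual_monoidal_functor : monoidal_functor dual_monoidal_data.
Proof.
split.
- move=> X X' Y Y' f g; apply: nhom_eq => p; apply: nhom_eq.
  pose p' := wedge_map (dual_fmap wd f) (dual_fmap wd g) p.
  apply: wedge_ext => x.
    apply: (etrans (@dual_sum_left X' Y' p' (inl _ _ x) erefl)).
    apply/esym/(@dual_sum_left X Y p (wedge_map f g (inl _ _ x))).
    exact: (mfun_base (nfun g)).
  apply: (etrans (@dual_sum_right X' Y' p' (inr _ _ x) erefl)).
  apply/esym/(@dual_sum_right X Y p (wedge_map f g (inr _ _ x))).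
  exact: (mfun_base (nfun f)).
- move=> X Y W; apply: nhom_eq => p; apply: nhom_eq.
  (* [p'] and [p''] are what the two sides of the associativity diagram feed to their last
     [dual_sum]. *)
  pose p' : wedge (PD (pwedge X Y)) (PD W) :=
    @wedge_map A (pwedge (PD X) (PD Y)) (PD (pwedge X Y)) (PD W) (PD W)
      (ito (dual_mu X Y)) (nid _) p.
  pose p'' : wedge (PD X) (PD (pwedge Y W)) :=
    @wedge_map A (PD X) (PD X) (pwedge (PD Y) (PD W)) (PD (pwedge Y W))
      (nid _) (ito (dual_mu Y W)) (assoc_fun p).
  apply: wedge_ext => [x|yw].
    pose x' := assoc_inv_fun (inl X (pwedge Y W) x).
    apply: (etrans (@dual_sum_left (pwedge X Y) W p' x' erefl)).
    apply: (etrans (@dual_sum_left X Y (sval p).1 (sval x').1 erefl)).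
    exact: esym (@dual_sum_left X (pwedge Y W) p'' (inl _ _ x) erefl).
  pose x' := assoc_inv_fun (inr X (pwedge Y W) yw).
  apply: etrans (esym (@dual_sum_right X (pwedge Y W) p'' (inr _ _ yw) erefl)).
  case: (svalP yw) => yw0.
    apply: (etrans (@dual_sum_right (pwedge X Y) W p' x' _)).
      by apply: wedge_eq; congr pair.
    exact: esym (@dual_sum_right Y W (sval (assoc_fun p)).2 yw yw0).
  apply: (etrans (@dual_sum_left (pwedge X Y) W p' x' yw0)).
  apply: (etrans (@dual_sum_right X Y (sval p).1 (sval x').1 erefl)).
  exact: esym (@dual_sum_left Y W (sval (assoc_fun p)).2 yw yw0).
- move=> X; apply: nhom_eq => p; apply: nhom_eq => x.
  pose p' := @wedge_map A (zob Z) (PD (zob Z)) (PD X) (PD X) (ito dual_eta)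
    (nid _) p.
  exact: (@dual_sum_right (zob Z) X p' (inr _ _ x) erefl).
- move=> X; apply: nhom_eq => p; apply: nhom_eq => x.
  pose p' := @wedge_map A (PD X) (PD X) (zob Z) (PD (zob Z)) (nid _)
    (ito dual_eta) p.
  exact: (@dual_sum_left X (zob Z) p' (inl _ _ x) erefl).
- move=> X Y; apply: nhom_eq => p; apply: nhom_eq; apply: wedge_ext => x.
    apply: (etrans (@dual_sum_right X Y p (swap Y X (inl _ _ x)) erefl)).
    exact: (esym (@dual_sum_left Y X (swap _ _ p) (inl _ _ x) erefl)).
  apply: (etrans (@dual_sum_left X Y p (swap Y X (inr _ _ x)) erefl)).
  exact: (esym (@dual_sum_right Y X (swap _ _ p) (inr _ _ x) erefl)).
Qed.

(** At [f] and [m] the composite is [eps * sigma (eps * sigma (f m))], which equals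
    [f m * (eps * sigma eps)]. *)
Lemma Theta_coherence U :
  (dmap P (Theta wd U) \oc Theta wd (P U) = idm (P U))%cat.
Proof.
apply: nhom_eq => f; apply: nhom_eq => m.
rewrite /= /theta_fun /= /theta_fun (involM sigmaP) (involK sigmaP).
by rewrite mulgA eps_central -mulgA eps_sigma mulg1.
Qed.

Lemma Theta_iso M : @is_iso (projn A) M (P (P M)) (Theta wd M).
Proof.
have TI : injective (Theta wd M).
  exact: (theta_injective eps_sigma (M := M)).
have [s sT] : exists s : nhom (P (P M)) M, cancel s (Theta wd M).
  apply: surjective_split => F.
  have [->|F0] := pselect (F = base (P (P M))).
    by exists (base M); rewrite mfun_base.
  have [f Ff] := @nhom_nonzero _ _ _ F (base (D (D M))) (fun=> erefl) F0.
  have [T [b [d B]]] := projective_basis cancA (projmodP M).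
  have f0 : f <> base (D M) by move=> f0; apply: Ff; rewrite f0 mfun_base.
  have [k [_ fk]] := dual_span revA B f0.
  pose bk := dual_basis_vector cancA sigmaP B k.
  pose c : A := F bk.
  have c0 : c <> 0.
    move=> c0; apply: Ff; rewrite fk mfun_act [F _]c0; exact: mul_pzero.
  (* The scalar is chosen so that evaluation at [bk] gives [eps * sigma (sigma c * eps) = c];
     agreeing with [F] at one point with nonzero value is then enough. *)
  exists (act (sigma c * eps) (b k)).
  have evalE : theta_fun (cancA := cancA) (sigmaP := sigmaP) eps
      (act (sigma c * eps) (b k)) bk = c.
    have [_ d1 _] := B; rewrite /theta_fun /= mfun_act d1 /= mulg1.
    rewrite (involM sigmaP) (involK sigmaP) mulgA eps_sigma; exact: mul1g.
  apply: (@dual_eq _ revA cancA _ sigmaP (PD M) _ _ bk); first exact: evalE.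
  by rewrite [X in X <> _]evalE.
apply/is_iso_nhom; exists s; split=> // x.
by apply: TI; rewrite sT.
Qed.

Lemma dual_is_duality : @is_duality (projn A) Z S E P (Theta wd).
Proof.
split.
- exact: dual_functor_proto_exact.
- exists dual_monoidal_data; split; first exact: dual_monoidal_functor.
  + move=> U V; apply: nhom_eq; apply: wedge_ext => x; apply: nhom_eq => h.
      (* The inverse of [dual_mu] splits [h] into its restrictions, and [inl x] sees only the
         restriction to the first factor. *)
      rewrite -[RHS]/((dual_sum (PD U) (PD V) (wedge_map (Theta wd U) (Theta wd V)
        (inl U V x)) : D _) (dual_split U V h)).
      by rewrite (@wedge_map_inl A U (PD (PD U)) V (PD (PD V))) dual_sum_inl.
    rewrite -[RHS]/((dual_sum (PD U) (PD V) (wedge_map (Theta wd U) (Theta wd V)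
      (inr U V x)) : D _) (dual_split U V h)).
    by rewrite (@wedge_map_inr A U (PD (PD U)) V (PD (PD V))) dual_sum_inr.
  + rewrite [LHS]from0_uniq; apply/esym/from0_uniq.
- by move=> X Y f; apply: nhom_eq => x; apply: nhom_eq.
- exact: Theta_iso.
- exact: Theta_coherence.
Qed.

End DualityAxioms.

Unset Implicit Arguments.

Theorem proposition2p6 (A : pointedMonoidType)
    (revA : right_reversible A)
    (cancA : right_partially_cancellative A)
    (sigma : A -> A) (sigmaP : pm_involution sigma)
    (eps : A) (eps_central : forall a : A, commute eps a)
    (eps_sigma : eps * sigma eps = 1) :
  exists wd : duality_well_defined cancA sigmaP eps_central,
    [/\ @proto_exact_with_duality (projn A) (projn_zero A) (wedge_tensor A)
          (projn_classes A) (dual_functor wd) (Theta wd),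
        uniquely_split (wedge_tensor A) (projn_classes A) &
        combinatorial (wedge_tensor A) (projn_classes A)].
Proof.
exists (duality_wd revA cancA sigmaP eps_central eps_sigma).
split; last exact: wedge_combinatorial.
  split; first exact: projn_proto_exact.
    exact: wedge_exact_direct_sum.
  exact: dual_is_duality.
exact: wedge_uniquely_split.
Qed.
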